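(* Let $\Omega\subset\mathbb{R}^n$ be a non-empty, bounded, open set and let $K\subset\mathbb{R}^m\times\mathbb{R}^m$ be compact. Then $$\mathcal Y_K^\infty=\bigcup_{P\in\mathcal P_{\widehat K}}\mathcal Y_P.$$
   Context: $\mathcal Pr(\mathbb{R}^d)$ is the set of Borel probability measures on $\mathbb{R}^d$; for $U\subset\mathbb{R}^k$ measurable with finite measure, $L^\infty_w(U;\mathcal Pr(\mathbb{R}^d))$ denotes the weakly$^\ast$ measurable maps $x\mapsto\nu_x$ from $U$ to finite signed Radon measures with $\nu_x\in\mathcal Pr(\mathbb{R}^d)$ for a.e. $x$ (Young measures). A sequence of measurable $z_j:U\to\mathbb{R}^d$ generates the Young measure $\nu$, written $z_j\stackrel{YM}{\longrightarrow}\nu$, if $\lim_{j}\int_U h(x)\varphi(z_j(x))\,dx=\int_U h(x)\int_{\mathbb{R}^d}\varphi(\xi)\,d\nu_x(\xi)\,dx$ for all $h\in L^1(U)$ and all $\varphi\in C_0(\mathbb{R}^d)$, the closure in the maximum norm of the smooth compactly supported functions. For $u\in L^1(\Omega;\mathbb{R}^m)$, $v_u(x,y):=(u(x),u(y))$ for $(x,y)\in\Omega\times\Omega$. For $E\subset\mathbb{R}^m\times\mathbb{R}^m$, $\mathcal A_E:=\{u\in L^\infty(\Omega;\mathbb{R}^m): v_u\in E\text{ a.e. in }\Omega\times\Omega\}$. $\mathcal Y^\infty_K:=\{\Lambda\in L^\infty_w(\Omega\times\Omega;\mathcal Pr(\mathbb{R}^m\times\mathbb{R}^m)): v_{u_j}\stackrel{YM}{\longrightarrow}\Lambda\text{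 with }(u_j)_j\subset\mathcal A_K\}$. For compact $C\subset\mathbb{R}^m\times\mathbb{R}^m$, $\mathcal Y_C$ is the set of all $\Lambda\in L^\infty_w(\Omega\times\Omega;\mathcal Pr(\mathbb{R}^m\times\mathbb{R}^m))$ such that there is $\nu\in L^\infty_w(\Omega;\mathcal Pr(\mathbb{R}^m))$ with $\Lambda_{(x,y)}=\nu_x\otimes\nu_y$ and $\operatorname{supp}\Lambda_{(x,y)}\subset C$ for a.e. $(x,y)\in\Omega\times\Omega$. $\widehat K:=\{(\xi,\zeta)\in K:(\xi,\xi),(\zeta,\xi),(\zeta,\zeta)\in K\}$. For $E\subset\mathbb{R}^m\times\mathbb{R}^m$, $\mathcal P_E$ is the set of maximal Cartesian subsets of $E$: sets $P=A\times A\subset E$ with $A\subset\mathbb{R}^m$ such that $B=A$ for any $B\subset\mathbb{R}^m$ with $A\subset B$ and $B\times B\subset E$. (Maximal Cartesian subsets of a compact set are compact.) *)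

(* Defs.v *)
From HB Require Import structures.
From mathcomp Require Import all_boot all_order all_algebra.
From mathcomp Require Import all_classical all_reals all_analysis.
From mathcomp Require Import measurable_realfun.

Set Implicit Arguments.
Unset Strict Implicit.
Unset Printing Implicit Defensive.

Import Order.TTheory GRing.Theory Num.Theory.
Import numFieldNormedType.Exports.

Local Open Scope classical_set_scope.
Local Open Scope ring_scope.

Notation borel V := (g_sigma_algebraType (@open V)).

(* Lebesgue measure on R^n, restricted to the Borel sets: R^n.+1 is identified
   with R * R^n through [rV_cons] and the measure is pushed forward from the
   product; [lebesgue_rV_box] is the normalization on boxes. *)
Section lebesgue_rV.
Context {R : realType}.

Definition rV_cons n (p : R * borel 'rV[R]_n) : borel 'rV[R]_n.+1 :=
  \row_(i < n.+1) oapp (fun j => p.2 ord0 j) p.1 (unlift ord0 i).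

Definition rV_uncons n (v : borel 'rV[R]_n.+1) : R * borel 'rV[R]_n :=
  (v ord0 ord0, \row_(j < n) v ord0 (lift ord0 j)).

Lemma rV_consK n : cancel (@rV_cons n) (@rV_uncons n).
Proof.
move=> [t v]; rewrite /rV_uncons /rV_cons/= mxE unlift_none; congr (_, _).
by apply/rowP => j; rewrite !mxE liftK.
Qed.

Lemma rV_unconsK n : cancel (@rV_uncons n) (@rV_cons n).
Proof.
move=> v; rewrite /rV_uncons /rV_cons/=; apply/rowP => i; rewrite mxE/=.
by case: unliftP => [j ->|->]//=; rewrite mxE.
Qed.

Lemma open_rV_bigcup_ball n (U : set 'rV[R]_n) : open U ->
  U = \bigcup_(a in [set a : 'rV[rat]_n * nat |
         ball (map_mx ratr a.1 : 'rV[R]_n) (a.2.+1%:R^-1) `<=` U])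
       ball (map_mx ratr a.1 : 'rV[R]_n) (a.2.+1%:R^-1).
Proof.
move=> oU; apply/seteqP; split => [x Ux|x [a aU]]; last exact: aU.
have /nbhs_ballP[e /= e0 xeU] := open_nbhs_nbhs (conj oU Ux).
have [k ke] : exists k : nat, k.+1%:R^-1 < e / 2.
  near \oo%classic => k; exists k; near: k.
  by apply: near_infty_natSinv_lt (PosNum (divr_gt0 e0 (ltr0n R 2))).
have /choice[q qx] (i : 'I_n) : exists q : rat, ball (x ord0 i) (k.+1%:R^-1) (ratr q).
  have k0 : 0 < k.+1%:R^-1 :> R by rewrite invr_gt0.
  have [|q] := @rat_in_itvoo R (x ord0 i - k.+1%:R^-1) (x ord0 i + k.+1%:R^-1).
    by rewrite ltrD2l gt0_cp.
  by move=> qi; exists q; rewrite ball_itv.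
have xq : ball (map_mx ratr (\row_i q i) : 'rV[R]_n) (k.+1%:R^-1) x.
  split; first by rewrite invr_gt0.
  by move=> i j; rewrite !mxE ord1; apply: ball_sym; exact: qx.
exists (\row_i q i, k) => //= y qy; apply: xeU.
apply: (@le_ball _ _ _ (k.+1%:R^-1 + k.+1%:R^-1)).
  by rewrite (splitr e) lerD// ltW.
by apply: ball_triangle qy; exact: ball_sym.
Unshelve. all: by end_near. Qed.

Lemma measurable_rV_cons n : measurable_fun setT (@rV_cons n).
Proof.
have H := @measurability _ _ _ _ setT (@rV_cons n) (@open 'rV[R]_n.+1).
apply: H => [|_ [U oU <-]]; first by [].
rewrite setTI [U]open_rV_bigcup_ball// preimage_bigcup bigcup_mkcond.
apply: countable_bigcupT_measurable => [|[q k]]; first exact: countableP.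
case: ifP => // _.
set r : R := k.+1%:R^-1; set c : 'rV[R]_n.+1 := map_mx _ _; clearbody r c.
rewrite [X in measurable X](_ : _ = ball (c ord0 ord0) r `*`
    (ball (\row_j c ord0 (lift ord0 j) : 'rV[R]_n) r : set (borel _))).
  apply: measurableX.
    by apply: open_measurable; exact: ball_open.
  apply: sub_sigma_algebra; exact: ball_open.
apply/seteqP; split => [[t v]/=[r0 B]|[t v]/= [Bt [r0 Bv]]].
  split.
    by have := B ord0 ord0; rewrite !mxE unlift_none.
  split=> // i j; have := B ord0 (lift ord0 j).
  by rewrite (ord1 i) !mxE liftK.
split=> // i j; rewrite (ord1 i) !mxE; case: unliftP => [l ->|->]//=.
by have := Bv ord0 l; rewrite mxE.
Qed.

Lemma measurable_rV_uncons n : measurable_fun setT (@rV_uncons n).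
Proof.
apply/measurable_fun_pairP; split.
  apply: (measurability _ (RGenOpens.measurableE R)) => _ [_ [a [b ->] <-]].
  rewrite setTI; apply: sub_sigma_algebra.
  apply: open_comp; last exact: interval_open.
  by move=> v _; exact: coord_continuous.
have H := @measurability _ _ _ _ setT (snd \o @rV_uncons n) (@open 'rV[R]_n).
apply: H => [|_ [U oU <-]]; first by [].
rewrite setTI; apply: sub_sigma_algebra.
apply: open_comp => // v _ W /nbhs_ballP[e /= e0 eW].
apply/nbhs_ballP; exists e => //= w [_ vw]; apply: eW.
by split => // i j; rewrite !mxE.
Qed.

(* The library instance of this fact is not found by canonical inference: it is
   shadowed by the one for products of subprobabilities. *)
Lemma sigma_finite_product d1 d2 (T1 : measurableType d1)
    (T2 : measurableType d2) (m1 : {sigma_finite_measure set T1 -> \bar R})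
    (m2 : {sigma_finite_measure set T2 -> \bar R}) :
  sigma_finite setT (m1 \x m2)%E.
Proof.
have /sigma_finiteP[F [TF ndF Foo]] := sigma_finiteT m1.
have /sigma_finiteP[G [TG ndG Goo]] := sigma_finiteT m2.
exists (fun n => F n `*` G n).
  rewrite -setXTT TF TG predeqE => -[x y]; split.
    move=> [/= [n _ Fnx] [k _ Gky]]; exists (maxn n k) => //; split.
    - by move: x Fnx; exact/subsetPset/ndF/leq_maxl.
    - by move: y Gky; exact/subsetPset/ndG/leq_maxr.
  by move=> [n _ []/= ? ?]; split; exists n.
move=> k; have [? ?] := Foo k; have [? ?] := Goo k.
split; first exact: measurableX.
by rewrite product_measure1E// lte_mul_pinfty// ge0_fin_numE.
Qed.

Section lebesgue_step.
Variables (n : nat) (mu : {sigma_finite_measure set (borel 'rV[R]_n) -> \bar R}).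

Definition lebesgue_step : set (borel 'rV[R]_n.+1) -> \bar R :=
  pushforward (lebesgue_measure \x mu)%E (@rV_cons n).

Let lebesgue_step0 : lebesgue_step set0 = 0%E.
Proof. by rewrite /lebesgue_step /pushforward preimage_set0 measure0. Qed.

Let lebesgue_step_ge0 A : (0 <= lebesgue_step A)%E.
Proof. by rewrite /lebesgue_step /pushforward measure_ge0. Qed.

Let lebesgue_step_sigma_additive : semi_sigma_additive lebesgue_step.
Proof.
move=> F mF tF mUF; rewrite /lebesgue_step /pushforward preimage_bigcup.
apply: measure_semi_sigma_additive.
- by move=> k; rewrite -[X in measurable X]setTI; exact: measurable_rV_cons.
- apply/trivIsetP => i j _ _ ij; rewrite -preimage_setI.
  by move/trivIsetP : tF => /(_ _ _ _ _ ij) ->//; rewrite preimage_set0.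
- by rewrite -preimage_bigcup -[X in measurable X]setTI; exact: measurable_rV_cons.
Qed.

HB.instance Definition _ := isMeasure.Build _ _ _ lebesgue_step
  lebesgue_step0 lebesgue_step_ge0 lebesgue_step_sigma_additive.

Let lebesgue_step_sigma_finite : sigma_finite setT lebesgue_step.
Proof.
have [F FT mF] := sigma_finite_product lebesgue_measure mu.
exists (fun k => @rV_uncons n @^-1` F k).
  by rewrite -preimage_bigcup -FT preimage_setT.
move=> k; have [mFk Fkoo] := mF k; split.
  by rewrite -[X in measurable X]setTI; exact: measurable_rV_uncons.
rewrite /lebesgue_step /pushforward/= -comp_preimage.
by rewrite (_ : _ \o _ = id)//; apply/funext => p; exact: rV_consK.
Qed.

HB.instance Definition _ := Measure_isSigmaFinite.Build _ _ _ lebesgue_step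
  lebesgue_step_sigma_finite.

End lebesgue_step.

Fixpoint lebesgue_rV n : {sigma_finite_measure set (borel 'rV[R]_n) -> \bar R} :=
  match n with
  | 0 => @dirac _ (borel 'rV[R]_0) 0 R
  | n'.+1 => lebesgue_step (lebesgue_rV n')
  end.

Definition rV_box n (a b : 'rV[R]_n) : set (borel 'rV[R]_n) :=
  [set x : 'rV[R]_n | forall i, a ord0 i <= x ord0 i <= b ord0 i].

Lemma rV_cons_box n (a b : 'rV[R]_n.+1) :
  @rV_cons n @^-1` rV_box a b = `[a ord0 ord0, b ord0 ord0] `*`
    rV_box (\row_j a ord0 (lift ord0 j)) (\row_j b ord0 (lift ord0 j)).
Proof.
apply/seteqP; split => [[t v]/= xab|[t v] [/= tab vab] i].
  split => [|i] /=.
    by have := xab ord0; rewrite !mxE unlift_none/= in_itv.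
  by have := xab (lift ord0 i); rewrite !mxE liftK.
rewrite !mxE; case: unliftP => [j ->|->]/=; last by rewrite in_itv in tab.
by have := vab j; rewrite !mxE.
Qed.

Lemma measurable_rV_box n (a b : 'rV[R]_n) : measurable (rV_box a b).
Proof.
elim: n a b => [|n IH] a b.
  by rewrite (_ : rV_box a b = setT)//; apply/seteqP; split => // x _ -[].
rewrite -[rV_box a b](preimage_id) -(_ : @rV_cons n \o @rV_uncons n = id).
  rewrite comp_preimage rV_cons_box -[X in measurable X]setTI.
  by apply: measurable_rV_uncons => //; exact: measurableX.
by apply/funext => v; exact: rV_unconsK.
Qed.

Lemma lebesgue_rV_box n (a b : 'rV[R]_n) : (forall i, a ord0 i <= b ord0 i) ->
  lebesgue_rV n (rV_box a b) = (\prod_(i < n) (b ord0 i - a ord0 i))%:E.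
Proof.
elim: n a b => [|n IH] a b ab.
  by rewrite big_ord0/= diracE mem_set// => -[].
rewrite [LHS]/= /lebesgue_step /pushforward rV_cons_box.
rewrite product_measure1E//; last exact: measurable_rV_box.
rewrite IH => [|i]; last by rewrite !mxE.
rewrite big_ord_recl EFinM; congr (_ * _)%E.
  apply: (etrans (lebesgue_measure_itv `[a ord0 ord0, b ord0 ord0])).
  rewrite /= lte_fin.
  have := ab ord0; rewrite le_eqVlt => /predU1P[->|->]; last by [].
  by rewrite ltxx subrr.
by congr EFin; apply: eq_bigr => i _; rewrite !mxE.
Qed.

End lebesgue_rV.

Section young_measures.
Context {R : realType}.
Local Open Scope ereal_scope.

(* C^k through directional derivatives: on a finite-dimensional space, f is C^k.+1
   iff all its directional derivatives exist everywhere and are C^k. *)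
Fixpoint Ck (V : normedModType R) (k : nat) (f : V -> R^o) : Prop :=
  if k is k'.+1 then
    forall v : V, (forall x, derivable f x v) /\ Ck k' (fun x => 'D_v f x)
  else continuous f.

Definition smooth (V : normedModType R) (f : V -> R^o) := forall k, Ck k f.

Definition compactly_supported (V : normedModType R) (f : V -> R^o) :=
  compact (closure [set x | f x != 0%R]).

(* The closure of the smooth compactly supported functions in the maximum
   norm. *)
Definition C0 (V : normedModType R) : set (V -> R) :=
  [set f | forall e : R, (0 < e)%R -> exists g : V -> R^o,
     [/\ smooth g, compactly_supported g & forall x, (`|f x - g x| <= e)%R]].

(* Values of Young measures are finite signed Borel measures (on R^d these are
   automatically Radon). The integral against a charge is the difference of the
   integrals against the two parts of its Jordan decomposition; it does not
   depend on the Hahn decomposition picked here. *)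
Section charge_integral.
Context (V : normedModType R) (nu : {charge set (borel V) -> \bar R}).

Definition hahn_pos : set (borel V) := projT1 (cid (Hahn_decomposition nu)).

Definition hahn_neg : set (borel V) :=
  projT1 (cid (projT2 (cid (Hahn_decomposition nu)))).

Lemma hahn_posneg : hahn_decomposition nu hahn_pos hahn_neg.
Proof. exact: projT2 (cid (projT2 (cid (Hahn_decomposition nu)))). Qed.

Definition charge_integral (f : V -> R) : \bar R :=
  \int[jordan_pos hahn_posneg]_x (f x)%:E -
  \int[jordan_neg hahn_posneg]_x (f x)%:E.

End charge_integral.

(* Charges and measures are functions on all sets, of which only the values on
   measurable sets are meaningful; hence no Leibniz equality. *)
Definition charge_eq d (T : measurableType d) (nu : {charge set T -> \bar R})
    (mu : set T -> \bar R) :=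
  forall A, measurable A -> nu A = mu A.

(* supp nu = supp |nu|: |nu|(U) > 0 iff some measurable A in U has nu A != 0. *)
Definition charge_support (V : normedModType R)
    (nu : {charge set (borel V) -> \bar R}) : set V :=
  [set z | forall U : set V, open U -> U z ->
     exists A : set (borel V), [/\ measurable A, A `<=` U & nu A != 0]].

(* L^oo_w(U; Pr(V)). Functions are total on the ambient space, only their
   restriction to U matters. Essential boundedness of the total variation is
   implied by the a.e. condition. *)
Definition Linfw_Pr d (T : measurableType d) (mu : {measure set T -> \bar R})
    (U : set T) (V : normedModType R) :
    set (T -> {charge set (borel V) -> \bar R}) :=
  [set nu |
     (forall phi : V -> R, C0 phi ->
        measurable_fun U (fun x => charge_integral (nu x) phi)) /\
     {ae mu, forall x, U x ->
        exists p : probability (borel V) R, charge_eq (nu x) p}].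

Definition generates_YM d (T : measurableType d)
    (mu : {measure set T -> \bar R}) (U : set T) (V : normedModType R)
    (z : nat -> T -> V) (nu : T -> {charge set (borel V) -> \bar R}) :=
  forall (h : T -> R) (phi : V -> R),
    mu.-integrable U (EFin \o h) -> C0 phi ->
    \int[mu]_(x in U) (h x * phi (z j x))%:E @[j --> \oo] -->
    \int[mu]_(x in U) ((h x)%:E * charge_integral (nu x) phi).

Section nonlocal.
Variables (n m : nat) (Omega : set 'rV[R]_n).

Local Notation X := (borel 'rV[R]_n).
Local Notation Y := (borel 'rV[R]_m).
Local Notation YY := ('rV[R]_m * 'rV[R]_m)%type.
Local Notation leb := (lebesgue_rV n).
Local Notation leb2 := (product_measure1 (lebesgue_rV n) (lebesgue_rV n)).
Implicit Types (u : X -> Y) (E : set ('rV[R]_m * 'rV[R]_m)).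

Definition Linf : set (X -> Y) :=
  [set u : X -> Y | measurable_fun (Omega : set X) u /\
     exists M : R, {ae leb, forall x, Omega x ->
       (`|u x : 'rV[R]_m| <= M)%R}].

Definition nonlocal_field u (z : X * X) : 'rV[R]_m * 'rV[R]_m :=
  (u z.1, u z.2).

Definition calA E : set (X -> Y) :=
  [set u : X -> Y | Linf u /\
     {ae leb2, forall z, (Omega `*` Omega) z -> E (nonlocal_field u z)}].

(* Y^oo_E *)
Definition YMinfty E : set (X * X -> {charge set (borel YY) -> \bar R}) :=
  [set Lambda | Linfw_Pr leb2 (Omega `*` Omega) Lambda /\
     exists u : nat -> X -> Y, (forall j, calA E (u j)) /\
       generates_YM leb2 (Omega `*` Omega)
         (fun j => nonlocal_field (u j)) Lambda].

(* Y_E. As nu x is only a.e. a probability measure, the product of nu x and nu y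
   is taken through probability measures representing them. *)
Definition YMprod E : set (X * X -> {charge set (borel YY) -> \bar R}) :=
  [set Lambda | Linfw_Pr leb2 (Omega `*` Omega) Lambda /\
     exists2 nu : X -> {charge set (borel 'rV[R]_m) -> \bar R},
       Linfw_Pr leb Omega nu &
       {ae leb2, forall z, (Omega `*` Omega) z ->
          (exists p q : probability (borel 'rV[R]_m) R,
             [/\ charge_eq (nu z.1) p, charge_eq (nu z.2) q &
                 charge_eq (Lambda z) (p \x q)]) /\
          charge_support (Lambda z) `<=` E}].

End nonlocal.

(* E |-> \hat E *)
Definition hat m (K : set ('rV[R]_m * 'rV[R]_m)) : set ('rV[R]_m * 'rV[R]_m) :=
  [set p | [/\ K p, K (p.1, p.1), K (p.2, p.1) & K (p.2, p.2)]].

Definition max_cartesian m (E : set ('rV[R]_m * 'rV[R]_m)) :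
    set (set ('rV[R]_m * 'rV[R]_m)) :=
  [set P | exists A : set 'rV[R]_m,
     [/\ P = A `*` A, P `<=` E &
         forall B : set 'rV[R]_m, A `<=` B -> B `*` B `<=` E -> B = A]].

End young_measures.

(* Main.v *)
From HB Require Import structures.
Require Import Defs.
From mathcomp Require Import all_boot all_order all_algebra.
From mathcomp Require Import all_classical all_reals all_analysis.
From mathcomp Require Import measurable_realfun ring lra.

Set Implicit Arguments.
Unset Strict Implicit.
Unset Printing Implicit Defensive.

Import Order.TTheory GRing.Theory Num.Theory.
Import numFieldNormedType.Exports.

Local Open Scope classical_set_scope.
Local Open Scope ring_scope.

(** Both sides consist of the products [nu x \x nu y] carried by a Cartesian
    subset of [K].

    _Limits of nonlocal fields are products._  Test the convergence of
    [(u l x, u l y)] to [Lam] with the indicator of a rectangle [E `*` F] and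
    the function [f (w.1) * g (w.2)].  The approximants are products
    [a l f E * a l g F] of integrals over [E] and over [F].  The factors need
    not converge, but such products satisfy the exchange relation
    [(a b) (a' b') = (a b') (a' b)], and it survives in the limit
    ([s_exchange]).  Taking for the second pair the whole domain and the whole
    space expresses the limit as [r f E * r g F], where [r] integrates the
    kernel [nu] whose value at [x] is the average over [y] of the first
    marginals of [Lam (x, y)].  A monotone class argument yields
    [Lam (x, y) = nu x \x nu y] almost everywhere.  Let [A] be the support of
    the average of [nu].  If a basic rectangle [C i `*` C j] misses [K], then
    the approximants vanish on it, so that the average of [nu] cannot charge
    both [C i] and [C j]; thus [A `*` A] is contained in [K]
    ([limit_structure]), and by Zorn's lemma in a maximal Cartesian subset of
    [hat K] ([max_cartesian_extension]).

    _Products are limits._  A maximal Cartesian set is [A `*` A] with [A]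
    compact ([max_cartesian_compact]), and [nu x] is carried by [A] for almost
    every [x] ([tensor_values]).  Lebesgue measure being divisible
    ([lebesgue_rV_split]), there are maps [u j] with values in [A] that
    reproduce exactly the integrals of [nu x B] over [E], for [E] among the
    first [j] sets of a countable base of the domain and [B] in the partition
    generated by the first [j] sets of a countable base of the target
    ([sampling]).  On rectangles the statistics of [(u j x, u j y)] factorize,
    so they are those of [nu x \x nu y]; as a continuous function oscillates
    little on the cells that meet the compact set [A `*` A]
    ([compact_oscillation]), the desired convergence holds against indicators
    of basic rectangles, hence against every integrable function
    ([weak_star], [generating_sequence]).  The values stay in
    [A `*` A `<=` K], so the sequence is admissible.

    In both directions Young measures are only known through their integrals
    against smooth compactly supported functions.  The passage to sets rests
    on countable bases of open sets whose indicators are increasing limits of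
    such functions, built from [exp (- 1 / t)] ([bump_base_rV],
    [bump_base_pair]). *)

(** * Smooth functions *)

Section smooth_functions.
Context {R : realType}.

Lemma smooth_continuous (V : normedModType R) (f : V -> R^o) :
  smooth f -> continuous f.
Proof. by move=> /(_ 0%N). Qed.

Lemma smooth_derivable (V : normedModType R) (f : V -> R^o) x v :
  smooth f -> derivable f x v.
Proof. by move=> /(_ 1%N) /(_ v) [+ _]; apply. Qed.

Lemma smooth_derive (V : normedModType R) (f : V -> R^o) v :
  smooth f -> smooth (fun x => 'D_v f x).
Proof. by move=> sf k; have [_] := sf k.+1 v. Qed.

Lemma smooth_cst (V : normedModType R) (a : R) : smooth (fun _ : V => a : R^o).
Proof.
move=> k; elim: k a => [|k IH] a; first by move=> x; exact: cvg_cst.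
move=> v; split=> [x|]; first exact: derivable_cst.
rewrite (_ : (fun x => 'D_v _ x) = fun=> (0 : R) : R^o); first exact: (IH 0).
by apply/funext => x; exact: derive_cst.
Qed.

Lemma CkD (V : normedModType R) k (f g : V -> R^o) :
  Ck k f -> Ck k g -> Ck k (fun x => f x + g x : R^o).
Proof.
elim: k f g => [|k IH] f g; first by move=> cf cg x; apply: cvgD; [exact: cf|exact: cg].
move=> sf sg v; have [df Df] := sf v; have [dg Dg] := sg v; split=> [x|].
  exact: derivableD.
rewrite (_ : (fun x => 'D_v _ x) = fun x => 'D_v f x + 'D_v g x : R^o).
  exact: IH.
by apply/funext => x; exact: deriveD.
Qed.

Lemma smoothM (V : normedModType R) (f g : V -> R^o) :
  smooth f -> smooth g -> smooth (fun x => f x * g x : R^o).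
Proof.
move=> sf sg k; elim: k f g sf sg => [|k IH] f g sf sg.
  by move=> x; apply: cvgM; exact: smooth_continuous.
move=> v; split=> [x|].
  by apply: derivableM; exact: smooth_derivable.
rewrite (_ : (fun x => 'D_v _ x) =
    fun x => f x * 'D_v g x + g x * 'D_v f x : R^o).
  by apply: CkD; apply: IH => //; exact: smooth_derive.
by apply/funext => x; apply: deriveM; exact: smooth_derivable.
Qed.

Lemma smooth_prod (V : normedModType R) (I : Type) (r : seq I) (f : I -> V -> R^o) :
  (forall i, smooth (f i)) -> smooth (fun x => \prod_(i <- r) f i x : R^o).
Proof.
move=> sf; elim: r => [|i r IH].
  rewrite (_ : (fun _ => _) = fun=> 1 : R^o); first exact: smooth_cst.
  by apply/funext => x; rewrite big_nil.
rewrite (_ : (fun _ => _) = fun x => f i x * \prod_(j <- r) f j x : R^o).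
  exact: smoothM.
by apply/funext => x; rewrite big_cons.
Qed.

(** [L] is affine with linear part [l]. *)
Lemma derive_affine (V W : normedModType R) (F : W -> R^o) (L : V -> W)
    (l : V -> W) : (forall h v x, L (h *: v + x) = h *: l v + L x) ->
  forall x v, (derivable F (L x) (l v) -> derivable (F \o L) x v) /\
              'D_v (F \o L) x = 'D_(l v) F (L x).
Proof.
move=> HL x v; rewrite /derivable /derive.
suff -> : (fun h : R => h^-1 *: (((F \o L) \o shift x) (h *: v) - (F \o L) x)) =
  (fun h : R => h^-1 *: ((F \o shift (L x)) (h *: l v) - F (L x))) by [].
by apply/funext => h /=; rewrite HL.
Qed.

Lemma smooth_comp_affine (V W : normedModType R) (F : W -> R^o) (L : V -> W)
    (l : V -> W) : (forall h v x, L (h *: v + x) = h *: l v + L x) ->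
  continuous L -> smooth F -> smooth (F \o L).
Proof.
move=> HL cL sF k; elim: k F sF => [|k IH] F sF.
  by move=> x; apply: continuous_comp; [exact: cL|exact: smooth_continuous].
move=> v; split=> [x|].
  by apply: (derive_affine F HL x v).1; exact: smooth_derivable.
rewrite (_ : (fun x => 'D_v _ x) = (fun y => 'D_(l v) F y) \o L).
  by apply: IH; exact: smooth_derive.
by apply/funext => x /=; exact: (derive_affine F HL x v).2.
Qed.

End smooth_functions.

(** * Bump functions *)

Section flat_functions.
Context {R : realType}.

Lemma exprn_le_expR n (s : R) : 0 <= s -> s ^+ n <= n%:R ^+ n * expR s.
Proof.
case: n => [|n] s0; first by rewrite !expr0 mul1r -(expR0 R) ler_expR.
have n0 : 0 < n.+1%:R :> R by rewrite ltr0n.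
have : s / n.+1%:R <= expR (s / n.+1%:R).
  by rewrite (le_trans _ (expR_ge1Dx _))// lerDr.
move=> h.
have {}h : (s / n.+1%:R) ^+ n.+1 <= expR (s / n.+1%:R) ^+ n.+1.
  by rewrite lerXn2r ?nnegrE ?expR_ge0// divr_ge0.
move: h; rewrite -expRM_natl [_ * (s / _)]mulrC divfK ?gt_eqF//.
by rewrite expr_div_n ler_pdivrMr ?exprn_gt0// mulrC.
Qed.

Lemma horner_le_expR (p : {poly R}) :
  exists2 M, 0 <= M & forall s, 0 <= s -> `|p.[s]| <= M * expR s.
Proof.
exists (\sum_(i < size p) `|p`_i| * i%:R ^+ i).
  by apply: sumr_ge0 => i _; rewrite mulr_ge0// exprn_ge0.
move=> s s0; rewrite horner_coef mulr_suml; apply: (le_trans (ler_norm_sum _ _ _)).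
apply: ler_sum => i _; rewrite normrM -mulrA ler_wpM2l//.
by rewrite ger0_norm ?exprn_ge0// exprn_le_expR.
Qed.

(** The function [p (1 / t) * exp (- 1 / t)] for [t > 0], extended by [0]. The
    polynomial factor makes the family stable under derivation. *)
Definition flat (p : {poly R}) (t : R) : R^o :=
  if 0 < t then p.[t^-1] * expR (- t^-1) else 0.

(** In particular [flat p] is continuous at [0], and [flat ('X * p)] is the
    difference quotient of [flat p] there. *)
Lemma flat_le (p : {poly R}) : exists2 M, 0 <= M & forall t, `|flat p t| <= M * `|t|.
Proof.
have [M M0 Mp] := horner_le_expR ('X * p).
exists M => // t; rewrite /flat; case: ifPn => [t0|_]; last by rewrite normr0 mulr_ge0.
rewrite normrM (ger0_norm (expR_ge0 _)) (gtr0_norm t0).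
have tV0 : 0 <= t^-1 by rewrite invr_ge0 ltW.
have := Mp _ tV0; rewrite hornerM hornerX normrM (ger0_norm tV0) => h.
rewrite expRN ler_pdivrMr ?expR_gt0//.
by rewrite mulrAC -ler_pdivrMr// mulrC.
Qed.

Lemma is_derive_flat (p : {poly R}) (t : R) :
  is_derive t (1 : R) (flat p) (flat ('X^2 * (p - p^`())) t).
Proof.
have [t0|t0|->] := ltrgtP t 0.
- have -> : flat ('X^2 * (p - p^`())) t = 0 by rewrite /flat ltNge (ltW t0).
  apply: (@near_eq_is_derive _ _ _ (cst (0 : R^o))).
  near=> z; rewrite /flat ltNge (_ : z <= 0)//; apply: ltW; near: z.
  exact: lt_nbhsl.
- rewrite {2}/flat t0.
  apply: (@near_eq_is_derive _ R^o R^o (fun t : R => p.[t^-1] * expR (- t^-1) : R^o)).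
    near=> z; rewrite /flat ifT//; near: z; exact: lt_nbhsr.
  have V1 : is_derive t (1 : R) (fun t => t^-1) (- t ^- 2).
    have tn0 : id t != 0 by rewrite gt_eqF.
    apply: (is_derive_eq (is_deriveV tn0 (is_derive_id _ _))).
    by rewrite /GRing.scale/= mulr1.
  have V2 : is_derive t (1 : R) (horner p \o (fun t => t^-1))
      (p^`().[t^-1] * - t ^- 2) by exact: is_derive1_comp.
  have V3 : is_derive t (1 : R) (expR \o (fun t => - t^-1))
      (expR (- t^-1) * t ^- 2).
    have V4 : is_derive t (1 : R) (fun t => - t^-1) (t ^- 2).
      by apply: (is_derive_eq (is_deriveN V1)); rewrite opprK.
    exact: is_derive1_comp.
  apply: (is_derive_eq (is_deriveM V2 V3)).
  rewrite /GRing.scale/= hornerM hornerXn hornerD hornerN exprVn.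
  by ring.
- rewrite {2}/flat ltxx.
  have [M M0 Mp] := flat_le ('X * p).
  have H : h^-1 *: (flat p (h *: 1 + 0) - flat p 0) @[h --> 0^'] --> (0 : R^o).
    apply/cvgr0Pnorm_le => e e0.
    near=> h.
    have h0 : h != 0 by near: h; exact: nbhs_dnbhs_neq.
    rewrite addr0 [in X in _ - X]/flat ltxx subr0 /GRing.scale/= mulr1.
    have -> : h^-1 * flat p h = flat ('X * p) h.
      rewrite /flat; case: ifP => _; last by rewrite mulr0.
      by rewrite hornerM hornerX mulrA.
    rewrite (le_trans (Mp _))//.
    have : `|h| <= e / (M + 1).
      near: h; apply: dnbhs0_le; rewrite divr_gt0// ltr_wpDl//.
    rewrite ler_pdivlMr ?ltr_wpDl// mulrC => /(le_trans _); apply.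
    by rewrite ler_wpM2r// lerDl.
  apply: DeriveDef; first by apply/cvg_ex; exists 0.
  exact: cvg_lim H.
Unshelve. all: by end_near. Qed.

(** By induction on the order: the directional derivatives of [flat p] are again
    of the form [flat q]. *)
Lemma smooth_flat (p : {poly R}) : smooth (flat p).
Proof.
move=> k; elim: k p => [|k IH] p.
  move=> t; apply: differentiable_continuous; apply/derivable1_diffP.
  by have [] := is_derive_flat p t.
move=> v; have H t : is_derive t v (flat p) (v * flat ('X^2 * (p - p^`())) t).
  have [d D] := is_derive_flat p t; apply: DeriveDef.
    exact/diff_derivable/derivable1_diffP.
  rewrite deriveE; last exact/derivable1_diffP.
  by rewrite deriv1E// derive1E D.
split=> [t|]; first by have [] := H t.
rewrite (_ : (fun x => 'D_v _ x) = fun t =>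
  flat (v%:P * ('X^2 * (p - p^`()))) t); first exact: IH.
apply/funext => t; have [_ ->] := H t.
by rewrite /flat; case: ifP => _; rewrite ?mulr0// [(v%:P * _).[_]]hornerM hornerC mulrA.
Qed.

End flat_functions.

Section bump_bases.
Context {R : realType}.

(** [exp (- 1 / t)] for [t > 0], and [0] otherwise. *)
Definition flat1 : R -> R := flat 1.

Lemma flat1E (t : R) : flat1 t = if 0 < t then expR (- t^-1) else 0.
Proof. by rewrite /flat1 /flat; case: ifP => // _; rewrite hornerE mul1r. Qed.

Lemma flat1_ge0 t : 0 <= flat1 t.
Proof. by rewrite flat1E; case: ifP => // _; exact: expR_ge0. Qed.

Lemma flat1_le1 t : flat1 t <= 1.
Proof.
by rewrite flat1E; case: ifP => // t0; rewrite expR_le1 oppr_le0 invr_ge0 ltW.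
Qed.

Lemma flat1_le0 t : t <= 0 -> flat1 t = 0.
Proof. by rewrite flat1E ltNge => ->. Qed.

Lemma flat1_nd (k l : nat) (s t : R) : (k <= l)%N -> s <= t ->
  flat1 (k.+1%:R * s) <= flat1 (l.+1%:R * t).
Proof.
move=> kl st; have [s0|s0] := leP s 0.
  by rewrite flat1_le0 ?mulr_ge0_le0// flat1_ge0.
have t0 : 0 < t by exact: lt_le_trans st.
rewrite !flat1E !mulr_gt0// ler_expR lerN2 lef_pV2 ?posrE ?mulr_gt0//.
by rewrite ler_pM ?ler_nat// ltW.
Qed.

(** [flat1 (k * s)] converges to [1] when [s] stays away from [0]. *)
Lemma flat1_cvg (s : nat -> R) (c : R) : 0 < c ->
  (\forall k \near \oo, c <= s k) ->
  flat1 (k.+1%:R * s k) @[k --> \oo] --> (1 : R).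
Proof.
move=> c0 cs.
apply: (@squeeze_cvgr _ _ _ _ (fun k => 1 - c^-1 * k.+1%:R^-1) (fun=> 1)).
- near=> k; rewrite flat1_le1 andbT.
  have sk : c <= s k by near: k.
  have sk0 : 0 < s k by exact: lt_le_trans sk.
  rewrite flat1E mulr_gt0// (le_trans _ (expR_ge1Dx _))// lerD2l lerN2 invfM.
  by rewrite mulrC ler_wpM2r// lef_pV2.
- rewrite -[X in _ --> X]subr0; apply: cvgB; first exact: cvg_cst.
  rewrite -[X in _ --> X](mulr0 c^-1); apply: cvgM; first exact: cvg_cst.
  exact: cvg_harmonic.
- exact: cvg_cst.
Unshelve. all: by end_near. Qed.

Variable m : nat.
Implicit Types (a b x : 'rV[R]_m) (k : nat).

(** The box with opposite corners [a] and [b]; it is empty when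
    [b ord0 i <= a ord0 i] for some [i]. *)
Definition open_box a b : set 'rV[R]_m :=
  [set x | forall i, a ord0 i < x ord0 i < b ord0 i].

(** A smooth function vanishing outside of [open_box a b] and, on it, increasing
    to [1] with [k]. *)
Definition bump a b k x : R :=
  \prod_i (flat1 (k.+1%:R * (x ord0 i - a ord0 i)) *
           flat1 (k.+1%:R * (b ord0 i - x ord0 i))).

Lemma bump_smooth a b k : smooth (bump a b k : 'rV[R]_m -> R^o).
Proof.
have coordc (i : 'I_m) : continuous (fun x : 'rV[R]_m => x ord0 i).
  by move=> x; exact: coord_continuous.
apply: (@smooth_prod R _ _ _ (fun i (x : 'rV[R]_m) =>
  flat1 (k.+1%:R * (x ord0 i - a ord0 i)) *
  flat1 (k.+1%:R * (b ord0 i - x ord0 i)) : R^o)) => i.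
have lhs : smooth ((flat 1 : R^o -> R^o) \o
    (fun x : 'rV[R]_m => k.+1%:R * (x ord0 i - a ord0 i) : R^o)).
  apply: (@smooth_comp_affine R 'rV[R]_m R^o (flat 1) _
    (fun v => k.+1%:R * v ord0 i)).
  - by move=> h v x; rewrite !mxE /GRing.scale/=; ring.
  - move=> x; exact: (cvgM (cvg_cst _) (cvgB (coordc i x) (cvg_cst _))).
  - exact: smooth_flat.
have rhs : smooth ((flat 1 : R^o -> R^o) \o
    (fun x : 'rV[R]_m => k.+1%:R * (b ord0 i - x ord0 i) : R^o)).
  apply: (@smooth_comp_affine R 'rV[R]_m R^o (flat 1) _
    (fun v => - (k.+1%:R * v ord0 i))).
  - by move=> h v x; rewrite !mxE /GRing.scale/=; ring.
  - move=> x; exact: (cvgM (cvg_cst _) (cvgB (cvg_cst _) (coordc i x))).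
  - exact: smooth_flat.
exact: (smoothM lhs rhs).
Qed.

Lemma bump_ge0 a b k x : 0 <= bump a b k x.
Proof. by apply: prodr_ge0 => i _; rewrite mulr_ge0// flat1_ge0. Qed.

Lemma bump_nd a b k a' b' k' x : (k <= k')%N ->
  (forall i, a' ord0 i <= a ord0 i) -> (forall i, b ord0 i <= b' ord0 i) ->
  bump a b k x <= bump a' b' k' x.
Proof.
move=> kk aa bb; apply: ler_prod => i _; rewrite mulr_ge0 ?flat1_ge0//=.
by rewrite ler_pM ?flat1_ge0// flat1_nd// ?lerB.
Qed.

Lemma bump_le1 a b k x : bump a b k x <= 1.
Proof.
apply: (@le_trans _ _ (\prod_(i < m) 1)); last by rewrite big1.
apply: ler_prod => i _; rewrite mulr_ge0 ?flat1_ge0//=.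
by rewrite mulr_ile1// ?flat1_ge0 ?flat1_le1.
Qed.

Lemma bump_out a b k x : ~ open_box a b x -> bump a b k x = 0.
Proof.
move=> /existsNP[i /negP]; rewrite negb_and -!leNgt => H.
rewrite /bump (bigD1 i)//=; case/orP : H => H.
  by rewrite flat1_le0 ?mul0r// mulr_ge0_le0// subr_le0.
by rewrite [X in _ * X * _]flat1_le0 ?mulr0 ?mul0r// mulr_ge0_le0// subr_le0.
Qed.

Lemma bump_compact a b k : compactly_supported (bump a b k : 'rV[R]_m -> R^o).
Proof.
pose Q : set 'rV[R]_m := [set x | forall i, `[a ord0 i, b ord0 i]%classic (x ord0 i)].
have cQ : compact Q.
  apply: (@rV_compact _ _ (fun i => `[a ord0 i, b ord0 i]%classic)) => i.
  exact: segment_compact.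
have clQ : closed Q.
  by apply: compact_closed cQ; exact: (@norm_hausdorff R 'rV[R]_m).
apply: (subclosed_compact (@closed_closure _ _) cQ).
rewrite closureE; apply: smallest_sub => // y /= /eqP.
apply: contra_notP => Qy; apply: bump_out => aby.
by apply: Qy => i; have /andP[? ?] := aby i; rewrite /= in_itv/= !ltW.
Qed.

(** The corners may depend on [k], provided that [x] remains at a distance at
    least [c] from the faces of the box. *)
Lemma bump_cvg (a b : nat -> 'rV[R]_m) x (c : R) : 0 < c ->
  (\forall k \near \oo, forall i, a k ord0 i + c <= x ord0 i <= b k ord0 i - c) ->
  bump (a k) (b k) k x @[k --> \oo] --> (1 : R).
Proof.
move=> c0 H; rewrite /bump.
rewrite [X in _ --> X](_ : _ = \prod_(i < m) (1 * 1))//; last first.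
  by rewrite big1// => i _; rewrite mulr1.
apply: cvg_big => [|i _].
  by apply: mul_continuous.
apply: cvgM; apply: (flat1_cvg c0).
- by apply: filterS H => k /(_ i) /andP[? _]; rewrite lerBrDl.
- by apply: filterS H => k /(_ i) /andP[_ ?]; rewrite lerBrDr addrC -lerBrDr.
Qed.

Lemma open_boxI (a b a' b' : 'rV[rat]_m) :
  open_box (map_mx ratr a) (map_mx ratr b) `&`
    open_box (map_mx ratr a') (map_mx ratr b') =
  open_box (map_mx ratr (\row_i Num.max (a ord0 i) (a' ord0 i)))
           (map_mx ratr (\row_i Num.min (b ord0 i) (b' ord0 i))).
Proof.
apply/seteqP; split=> [x [H H'] i|x H].
  have := H i; have := H' i; rewrite !mxE => /andP[? ?] /andP[? ?].
  by rewrite /Num.max /Num.min; case: ifP => _; case: ifP => _; apply/andP.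
split=> i; have := H i; rewrite !mxE => /andP[A B]; apply/andP; split.
- by apply: le_lt_trans A; rewrite ler_rat le_max lexx.
- by apply: lt_le_trans B _; rewrite ler_rat ge_min lexx.
- by apply: le_lt_trans A; rewrite ler_rat le_max lexx orbT.
- by apply: lt_le_trans B _; rewrite ler_rat ge_min lexx orbT.
Qed.

Lemma open_open_box a b : open (open_box a b).
Proof.
rewrite (_ : open_box a b = \big[setI/setT]_(i <- index_enum 'I_m)
    [set x | a ord0 i < x ord0 i < b ord0 i]); last first.
  rewrite -bigcap_seq; apply/seteqP; split=> x H i => [_|]; first exact: H.
  by apply: H; rewrite /= mem_index_enum.
elim/big_ind: _ => [|A B oA oB|i _]; [exact: openT|exact: openI|].
rewrite [X in open X](_ : _ = (fun x : 'rV[R]_m => x ord0 i) @^-1`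
   `]a ord0 i, b ord0 i[%classic); last first.
  by apply/seteqP; split=> x /=; rewrite in_itv.
apply: open_comp; last exact: interval_open.
by move=> x _; exact: coord_continuous.
Qed.

Lemma open_box_basis (U : set 'rV[R]_m) x : open U -> U x ->
  exists ab : 'rV[rat]_m * 'rV[rat]_m,
    open_box (map_mx ratr ab.1) (map_mx ratr ab.2) x /\
    open_box (map_mx ratr ab.1) (map_mx ratr ab.2) `<=` U.
Proof.
move=> oU Ux; have /nbhs_ballP[e /= e0 xeU] := open_nbhs_nbhs (conj oU Ux).
have /choice[a aP] (i : 'I_m) : exists q : rat,
    ratr q \in `](x ord0 i - e), (x ord0 i)[.
  by apply: rat_in_itvoo; rewrite ltrBlDr ltrDl.
have /choice[b bP] (i : 'I_m) : exists q : rat,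
    ratr q \in `](x ord0 i), (x ord0 i + e)[.
  by apply: rat_in_itvoo; rewrite ltrDl.
exists (\row_i a i, \row_i b i); split.
  move=> i; rewrite !mxE; have := aP i; have := bP i.
  by rewrite !in_itv/= => /andP[-> _] /andP[_ ->].
move=> y yab; apply: xeU; split=> // i j; rewrite ord1.
have := yab j; rewrite !mxE; have := aP j; have := bP j; rewrite !in_itv/=.
by rewrite ball_itv/= in_itv/= => /andP[? ?] /andP[? ?] /andP[? ?]; lra.
Qed.

End bump_bases.

(** [bump_base C f]: the [C i] form a base of the topology that is stable under
    binary intersections and contains the whole space, and the indicator of
    each [C i] is the increasing limit of the smooth compactly supported
    functions [f i k]. When [I] is countable, a finite measure is thus
    determined by its integrals against the [f i k]. *)
Definition bump_base {R : realType} {V : normedModType R} {I : Type}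
    (C : I -> set V) (f : I -> nat -> V -> R) :=
  [/\ forall i, open (C i),
      forall U x, open U -> U x -> exists i, C i x /\ C i `<=` U,
      forall i j, exists k, C i `&` C j = C k,
      exists i, C i = setT &
      forall i, [/\ forall k, smooth (f i k : V -> R^o),
        forall k, compactly_supported (f i k : V -> R^o),
        forall k x, 0 <= f i k x <= 1,
        forall x, nondecreasing_seq (f i ^~ x) &
        forall x, f i k x @[k --> \oo] --> (\1_(C i) x : R) ] ].

(** The base consists of the boxes with rational corners and, for the index
    [None], of the whole space. *)
Lemma bump_base_rV (R : realType) m :
  exists (C : option ('rV[rat]_m * 'rV[rat]_m) -> set 'rV[R]_m)
         (f : option ('rV[rat]_m * 'rV[rat]_m) -> nat -> 'rV[R]_m -> R),
    bump_base C f.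
Proof.
exists (fun i => if i is Some ab then
  open_box (map_mx ratr ab.1) (map_mx ratr ab.2) else setT).
exists (fun i k => if i is Some ab then
    bump (map_mx ratr ab.1) (map_mx ratr ab.2) k
  (* the boxes exhaust the space *)
  else bump (const_mx (- k%:R)) (const_mx k%:R) k).
split.
- by case=> [ab|]; [exact: open_open_box|exact: openT].
- by move=> U x oU /(open_box_basis oU)[ab abP]; exists (Some ab).
- move=> [ab|] [ab'|].
  + by eexists (Some (_, _)); exact: open_boxI.
  + by exists (Some ab); rewrite setIT.
  + by exists (Some ab'); rewrite setTI.
  + by exists None; rewrite setTI.
- by exists None.
- move=> [ab|]; split=> [k|k|k x|x k l kl|x].
  + exact: bump_smooth.
  + exact: bump_compact.
  + by rewrite bump_ge0 bump_le1.
  + exact: bump_nd.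
  + rewrite indicE; have [|] := boolP (_ \in _); rewrite ?inE ?notin_setE => xC.
      (* c is positive and at most the distance from x to each face *)
      pose d i := Num.min (x ord0 i - ratr (ab.1 ord0 i))
                          (ratr (ab.2 ord0 i) - x ord0 i).
      have [c c0 cd] : exists2 c, 0 < c & forall i, c <= d i.
        exists (\big[Num.min/1]_i d i); last by move=> i; exact: bigmin_le.
        apply: lt_bigmin => // i _; have := xC i; rewrite !mxE => /andP[? ?].
        by rewrite lt_min !subr_gt0; apply/andP.
      apply: (bump_cvg c0); apply: nearW => k i; have := cd i.
      by rewrite !mxE le_min => /andP[? ?]; apply/andP; split; lra.
    by apply: cvg_near_cst; apply: nearW => k; rewrite bump_out.
  + exact: bump_smooth.
  + exact: bump_compact.
  + by rewrite bump_ge0 bump_le1.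
  + apply: bump_nd => // i; rewrite !mxE ?lerN2 ler_nat//.
  + rewrite indicE in_setT; apply: (@bump_cvg _ _ _ _ _ 1) => //.
    have [n xn] : exists n : nat, forall i, `|x ord0 i| + 1 <= n%:R.
      exists (Num.bound (\sum_i `|x ord0 i| + 1)) => i.
      rewrite (le_trans _ (ltW (archi_boundP _)))//.
        by rewrite lerD2r (bigD1 i)//= lerDl sumr_ge0.
      by rewrite addr_ge0// sumr_ge0.
    exists n => // k /= nk i; rewrite !mxE.
    have : `|x ord0 i| + 1 <= k%:R by rewrite (le_trans (xn i))// ler_nat.
    by rewrite -lerBrDr ler_norml => /andP[? ?]; apply/andP; split; lra.
Qed.

Lemma bump_base_pair (R : realType) (V W : normedModType R) (I J : Type)
    (C : I -> set V) f (D : J -> set W) g :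
  bump_base C f -> bump_base D g ->
  bump_base (fun ij : I * J => C ij.1 `*` D ij.2)
    (fun ij k (z : V * W) => f ij.1 k z.1 * g ij.2 k z.2).
Proof.
move=> [oC bC IC [i0 TC] fC] [oD bD ID [j0 TD] gD]; split.
- move=> ij; rewrite (_ : _ `*` _ = fst @^-1` C ij.1 `&` snd @^-1` D ij.2)//.
  apply: openI; apply: open_comp => // z _; [exact: cvg_fst|exact: cvg_snd].
- move=> U [x y] oU Uxy; have /= [[P Q] /= [Px Qy] PQU] := open_nbhs_nbhs (conj oU Uxy).
  move: Px Qy; rewrite !nbhsE => -[P' [oP' P'x] P'P] [Q' [oQ' Q'y] Q'Q].
  have [i [Cix CiP]] := bC _ _ oP' P'x; have [j [Djy DjQ]] := bD _ _ oQ' Q'y.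
  exists (i, j); split=> // z [/= Cz Dz]; apply: PQU; split.
    exact/P'P/CiP.
  exact/Q'Q/DjQ.
- move=> [i j] [i' j'] /=; have [k kP] := IC i i'; have [l lP] := ID j j'.
  by exists (k, l) => /=; rewrite -kP -lP; apply/seteqP; split => z /=; tauto.
- by exists (i0, j0); rewrite /= TC TD setXTT.
- move=> [i j] /=; have [sf cf f01 ndf lf] := fC i; have [sg cg g01 ndg lg] := gD j.
  split=> [k|k|k z|z k l kl|[x y]].
  + have s1 : smooth ((f i k : V -> R^o) \o (@fst V W)).
      apply: (@smooth_comp_affine R (V * W)%type V (f i k) _ fst) => //.
      by move=> z; exact: cvg_fst.
    have s2 : smooth ((g j k : W -> R^o) \o (@snd V W)).
      apply: (@smooth_comp_affine R (V * W)%type W (g j k) _ snd) => //.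
      by move=> z; exact: cvg_snd.
    exact: (smoothM s1 s2).
  + have cQ := compact_setX (cf k) (cg k).
    apply: (subclosed_compact (@closed_closure _ _) cQ).
    rewrite closureE; apply: smallest_sub.
      rewrite (_ : closure _ `*` _ = fst @^-1` closure [set x | f i k x != 0] `&`
        snd @^-1` closure [set x | g j k x != 0])//.
      apply: closedI; apply: closed_comp => [z _|]; try exact: closed_closure.
        exact: cvg_fst.
      exact: cvg_snd.
    move=> z /=; rewrite mulf_eq0 negb_or => /andP[? ?].
    by split; apply: subset_closure.
  + have /andP[? ?] := f01 k z.1; have /andP[? ?] := g01 k z.2.
    by rewrite mulr_ge0//= mulr_ile1.
  + have /andP[? ?] := f01 k z.1; have /andP[? ?] := g01 k z.2.
    by rewrite ler_pM//; [exact: ndf|exact: ndg].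
  + rewrite (_ : \1_ _ _ = \1_(C i) x * \1_(D j) y :> R); last first.
      by rewrite !indicE in_setX/= -natrM mulnb.
    by apply: cvgM; [exact: lf|exact: lg].
Qed.

(** * Borel measures and charges tested by bump functions *)

Section borel_base.
Context {R : realType} {V : normedModType R} {I : countType}.
Variables (C : I -> set V) (f : I -> nat -> V -> R).
Hypothesis Cf : bump_base C f.
Local Open Scope ereal_scope.

Lemma measurable_baseE : @measurable _ (borel V) = <<s range C >>.
Proof.
have [oC bC _ _ _] := Cf.
apply/seteqP; split; apply: smallest_sub; try exact: smallest_sigma_algebra.
- move=> U oU; rewrite (_ : U = \bigcup_(i in [set i | C i `<=` U]) C i).
    rewrite bigcup_mkcond.
    apply: (@countable_bigcupT_measurable _ (g_sigma_algebraType (range C))).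
      exact: countableP.
    move=> i; case: ifP => _; last exact: measurable0.
    by apply: sub_sigma_algebra; exists i.
  apply/seteqP; split=> [x Ux|x [i CiU]]; last exact: CiU.
  by have [i [Cix CiU]] := bC _ _ oU Ux; exists i.
- by move=> _ [i _ <-]; apply: sub_sigma_algebra; exact: oC.
Qed.

Lemma setI_closed_base : setI_closed (range C).
Proof.
move=> _ _ [i _ <-] [j _ <-]; have [_ _ IC _ _] := Cf.
by have [k ->] := IC i j; exists k.
Qed.

Lemma measurable_base i : measurable (C i : set (borel V)).
Proof. by apply: sub_sigma_algebra; have [oC _ _ _ _] := Cf; exact: oC. Qed.

Lemma measure_unique_base (m1 m2 : {measure set (borel V) -> \bar R}) :
  m1 setT < +oo -> (forall i, m1 (C i) = m2 (C i)) ->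
  forall B, measurable B -> m1 B = m2 B.
Proof.
move=> m1oo m12 B mB; apply: (@measure_unique _ _ (borel V) (range C) (fun=> setT)) => //.
- exact: measurable_baseE.
- exact: setI_closed_base.
- by move=> _; have [_ _ _ [i <-] _] := Cf; exists i.
- by rewrite bigcup_const.
- by move=> _ [i _ <-].
Qed.

Lemma measurable_prob_base d (T : measurableType d)
    (q : T -> probability (borel V) R) :
  (forall i, measurable_fun setT (fun x => q x (C i))) ->
  forall B, measurable B -> measurable_fun setT (fun x => q x B).
Proof.
move=> qC B mB.
apply: (@dynkin_induction _ (borel V) (range C)
  (fun B => measurable_fun setT (fun x => q x B))) => //.
- exact: measurable_baseE.
- exact: setI_closed_base.
- rewrite (_ : (fun x => _) = cst 1%E); first exact: measurable_cst.
  by apply/funext => x; rewrite probability_setT.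
- by move=> _ [i _ <-].
- move=> S mS qS; rewrite (_ : (fun x => _) = (fun x => 1 - q x S)).
    by apply: emeasurable_funB => //; exact: measurable_cst.
  by apply/funext => x; rewrite probability_setC.
- move=> F mF tF qF.
  rewrite (_ : (fun x => _) = (fun x => \sum_(i <oo) q x (F i))).
    by apply: (@ge0_emeasurable_sum _ _ _ _ (fun i x => q x (F i)) predT).
  apply/funext => x; rewrite measure_semi_bigcup//.
  exact: bigcup_measurable.
- by rewrite -measurable_baseE.
Qed.

Lemma measurable_continuous_borel (g : V -> R) : continuous g ->
  measurable_fun setT (g : borel V -> R).
Proof.
move=> cg; apply: (measurability _ (RGenOpens.measurableE R)) => _ [_ [a [b ->] <-]].
rewrite setTI; apply: sub_sigma_algebra; apply: open_comp.
  by move=> v _; exact: cg.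
exact: interval_open.
Qed.

Lemma integral_bump_cvg (p : {measure set (borel V) -> \bar R}) i :
  \int[p]_x (f i k x)%:E @[k --> \oo] --> p (C i).
Proof.
have [_ _ _ _ /(_ i)[sf _ f01 ndf lf]] := Cf.
rewrite -[X in _ --> p X]setIT.
rewrite -(@integral_indic _ (borel V))//; last exact: measurable_base.
rewrite (_ : (fun x => (\1_(C i) x)%:E) =
    (fun x => limn (fun k => (f i k x)%:E))); last first.
  apply/funext => x; apply/esym/cvg_lim => //.
  by apply: cvg_EFin; [exact: nearW|exact: lf].
apply: (@cvg_monotone_convergence _ (borel V) _ p setT measurableT
  (fun k x => (f i k x)%:E)).
- move=> k; apply/measurable_EFinP; apply: measurable_continuous_borel.
  exact: smooth_continuous.
- by move=> k x _; rewrite lee_fin; have /andP[] := f01 k x.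
- by move=> x _ k l kl; rewrite lee_fin; exact: ndf.
Qed.

End borel_base.

Section charge_integrals.
Context {R : realType} {V : normedModType R}.
Local Open Scope ereal_scope.

(** A charge that agrees with a measure has no negative part. *)
Lemma charge_integralE (nu : {charge set (borel V) -> \bar R})
    (p : {measure set (borel V) -> \bar R}) (g : V -> R) :
  charge_eq nu p -> charge_integral nu g = \int[p]_x (g x)%:E.
Proof.
move=> nup; rewrite /charge_integral.
have [[mP _] [mN N0] PN PN0] := hahn_posneg nu.
have pN A : measurable A -> p (A `&` hahn_neg nu) = 0.
  move=> mA; have mAN : measurable (A `&` hahn_neg nu) by exact: measurableI.
  apply/eqP; rewrite eq_le measure_ge0 andbT -nup//.
  exact: N0.
rewrite (eq_measure_integral p); last first.
  move=> A mA _; transitivity (crestr0 nu mP A) => //.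
  rewrite /= /crestr0 mem_set//.
  rewrite -[A in RHS]setIT -PN setIUr measureU; first last.
  - by rewrite setIACA PN0 setI0.
  - exact: measurableI.
  - exact: measurableI.
  transitivity (p (A `&` hahn_pos nu) + 0); last by congr (_ + _); exact/esym/pN.
  by rewrite adde0 /crestr nup//; exact: measurableI.
rewrite [X in _ - X](eq_measure_integral mzero); last first.
  move=> A mA _; transitivity (- crestr0 nu mN A).
    exact: cjordan_negE.
  rewrite /= /crestr0 mem_set//.
  rewrite /crestr nup; last exact: measurableI.
  transitivity (- 0 : \bar R); last by rewrite oppe0.
  by congr (- _); exact: pN.
by rewrite integral_measure_zero sube0.
Qed.

End charge_integrals.

Section young_kernel.
Context {R : realType} {V : normedModType R} {I : countType}.
Variables (C : I -> set V) (f : I -> nat -> V -> R).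
Hypothesis Cf : bump_base C f.
Local Open Scope ereal_scope.

Lemma bump_C0 i k : C0 (f i k).
Proof.
have [_ _ _ _ /(_ i)[sf cf _ _ _]] := Cf.
by move=> e e0; exists (f i k); split => // x; rewrite subrr normr0 ltW.
Qed.

(** A map in [Linfw_Pr] coincides almost everywhere with a measurable kernel of
    probability measures: the measures of the sets of the base are limits of the
    integrals of bump functions, which depend measurably on the point. *)
Lemma Linfw_Pr_kernel d (T : measurableType d) (mu : {measure set T -> \bar R})
    (U : set T) (nu : T -> {charge set (borel V) -> \bar R}) :
  measurable U -> Linfw_Pr mu U nu ->
  exists q : T -> probability (borel V) R,
    (forall B, measurable B -> measurable_fun setT (fun x => q x B)) /\
    {ae mu, forall x, U x -> charge_eq (nu x) (q x)}.
Proof.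
move=> mU [mnu [N [mN N0 nuN]]].
have mUN : measurable (U `\` N) by exact: measurableD.
pose delta : probability (borel V) R := @dirac _ (borel V) 0%R R.
have P x : exists p : probability (borel V) R,
    if x \in U `\` N then charge_eq (nu x) p else p = delta.
  have [|_] := boolP (x \in U `\` N); last by exists delta.
  rewrite inE => -[Ux Nx]; apply: contrapT => H; apply: Nx; apply: nuN.
  by move=> /(_ Ux)[p pP]; apply: H; exists p.
(* off the measurable set where nu x is known to be a probability, take the
   Dirac measure at 0 *)
have [q qP] := choice P; exists q; split; last first.
  exists N; split=> // x /= H; apply: contrapT => Nx; apply: H => Ux.
  by have := qP x; rewrite mem_set.
apply: (measurable_prob_base Cf) => i.
rewrite -(setvU (U `\` N)); apply/measurable_funU => //.
  exact: measurableC.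
split.
  apply: (@eq_measurable_fun _ _ _ _ _ (cst (delta (C i)))).
    move=> x /[!inE] xUN; have := qP x; rewrite memNset// => ->//.
  exact: measurable_cst.
apply: (@emeasurable_fun_cvg _ _ _ _
  (fun k x => charge_integral (nu x) (f i k))).
  by move=> k; apply: measurable_funS (mnu _ (bump_C0 i k)) => //; exact: subDsetl.
move=> x UNx /=; have := qP x; rewrite mem_set// => nuq.
under eq_fun do rewrite (charge_integralE _ nuq).
exact: (integral_bump_cvg Cf).
Qed.

End young_kernel.

Section borel_product.
Context {R : realType} {V W : normedModType R} {I J : countType}.
Variables (C : I -> set V) (f : I -> nat -> V -> R).
Variables (D : J -> set W) (g : J -> nat -> W -> R).
Hypotheses (Cf : bump_base C f) (Dg : bump_base D g).
Local Open Scope ereal_scope.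

(** With a countable base, the Borel sets of the product are measurable for the
    product of the Borel sigma-algebras. *)
Lemma measurable_pair_borel :
  measurable_fun setT (fun z : borel V * borel W => z : borel (V * W)%type).
Proof.
have H := @measurability _ _ (borel V * borel W)%type (borel (V * W)%type) setT
  id (@open (V * W)%type).
apply: H => // _ [U oU <-].
rewrite setTI preimage_id.
have [_ bP _ _ _] := bump_base_pair Cf Dg.
rewrite (_ : U = \bigcup_(ij in [set ij | C ij.1 `*` D ij.2 `<=` U])
                   (C ij.1 `*` D ij.2)); last first.
  apply/seteqP; split=> [z Uz|z [ij CiU]]; last exact: CiU.
  by have [ij [Cz CU]] := bP _ _ oU Uz; exists ij.
rewrite bigcup_mkcond; apply: countable_bigcupT_measurable.
  exact: countableP.
move=> ij; case: ifP => _; last exact: measurable0.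
by apply: measurableX; [exact: measurable_base Cf _|exact: measurable_base Dg _].
Qed.

Lemma measurable_fst_borel :
  measurable_fun setT (fst : borel (V * W)%type -> borel V).
Proof.
have H := @measurability _ _ (borel (V * W)%type) (borel V) setT fst (@open V).
apply: H => // _ [U oU <-]; rewrite setTI; apply: sub_sigma_algebra.
by apply: open_comp => // z _; exact: cvg_fst.
Qed.

Lemma measurable_snd_borel :
  measurable_fun setT (snd : borel (V * W)%type -> borel W).
Proof.
have H := @measurability _ _ (borel (V * W)%type) (borel W) setT snd (@open W).
apply: H => // _ [U oU <-]; rewrite setTI; apply: sub_sigma_algebra.
by apply: open_comp => // z _; exact: cvg_snd.
Qed.

Lemma measurableX_borel (A : set (borel V)) (B : set (borel W)) :
  measurable A -> measurable B ->
  measurable (A `*` B : set (borel (V * W)%type)).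
Proof.
move=> mA mB; rewrite (_ : _ `*` _ = fst @^-1` A `&` snd @^-1` B)//.
apply: measurableI; rewrite -[X in measurable X]setTI.
  exact: measurable_fst_borel.
exact: measurable_snd_borel.
Qed.

(** [p \x q] is a measure on the product sigma-algebra, and [lam] one on the Borel
    sets of the product space. *)
Lemma prod_measure_unique_base (lam : probability (borel (V * W)%type) R)
    (p : probability (borel V) R) (q : probability (borel W) R) :
  (forall i j, lam (C i `*` D j) = p (C i) * q (D j)) ->
  forall B : set (borel (V * W)%type), measurable B -> lam B = (p \x q) B.
Proof.
move=> H B mB.
pose pq (A : set (borel (V * W)%type)) := (p \x q) A.
have pq0 : pq set0 = 0 by exact: (measure0 (p \x q)).
have pq_ge0 A : 0 <= pq A by exact: (measure_ge0 (p \x q)).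
have pqs : semi_sigma_additive pq.
  move=> F mF tF mUF; apply: (@measure_semi_sigma_additive _ _ _ (p \x q) F) => //.
  - by move=> k; rewrite -[F k]setTI; exact: (measurable_pair_borel _ (mF k)).
  - rewrite -[X in measurable X]setTI; exact: (measurable_pair_borel _ mUF).
pose Hpq := isMeasure.Build _ _ _ pq pq0 pq_ge0 pqs.
pose mpq : {measure set (borel (V * W)%type) -> \bar R} := HB.pack pq Hpq.
suff : lam B = mpq B by [].
apply: (measure_unique_base (bump_base_pair Cf Dg)) => //.
  by apply: le_lt_trans (ltry 1%R); exact: (probability_le1 lam measurableT).
move=> [i j] /=; rewrite H; apply/esym.
apply: product_measure1E.
  exact: (measurable_base Cf).
exact: (measurable_base Dg).
Qed.

End borel_product.

(** * Divisibility of Lebesgue measure *)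

Section lebesgue_rV_facts.
Context {R : realType} (n : nat).
Local Notation leb := (@lebesgue_rV R n).
Local Notation X := (borel 'rV[R]_n).

Lemma bounded_set_rV_box (Q : set 'rV[R]_n) : bounded_set Q ->
  exists2 M : R, 0 < M & Q `<=` rV_box (const_mx (- M)) (const_mx M).
Proof.
move=> [M [_ QM]]; exists (`|M| + 1); first by rewrite ltr_wpDl.
have {}QM : Q `<=` [set x | `|x| <= `|M| + 1].
  by move=> x /QM; apply; rewrite (le_lt_trans (ler_norm _))// ltrDl.
move=> x /QM/= xM i; rewrite !mxE -ler_norml; apply: le_trans xM.
by rewrite [leRHS]/Num.norm/= mx_normrE (le_bigmax _ (fun ij => `|x ij.1 ij.2|) (ord0, i)).
Qed.

Lemma lebesgue_rV_lty (Q : set X) : measurable Q -> bounded_set (Q : set 'rV[R]_n) ->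
  (leb Q < +oo)%E.
Proof.
move=> mQ /bounded_set_rV_box[M M0 QM].
apply: (@le_lt_trans _ _ (leb (rV_box (const_mx (- M)) (const_mx M)))).
  by apply: le_measure => //; rewrite inE//; exact: measurable_rV_box.
by rewrite lebesgue_rV_box ?ltry// => i; rewrite !mxE; lra.
Qed.

Lemma lebesgue_rV_gt0 (Q : set 'rV[R]_n) : open Q -> Q !=set0 ->
  (0 < leb Q)%E.
Proof.
move=> oQ [x Qx]; have /nbhs_ballP[e /= e0 xeQ] := open_nbhs_nbhs (conj oQ Qx).
pose a : 'rV[R]_n := \row_i (x ord0 i - e / 2).
pose b : 'rV[R]_n := \row_i (x ord0 i + e / 2).
apply: (@lt_le_trans _ _ (leb (rV_box a b))).
  rewrite lebesgue_rV_box => [|i]; last by rewrite !mxE; lra.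
  by rewrite lte_fin; apply: prodr_gt0 => i _; rewrite !mxE; lra.
apply: le_measure; rewrite ?inE; first exact: measurable_rV_box.
  exact: sub_sigma_algebra.
move=> y yab; apply: xeQ; split=> // i j; rewrite ord1 ball_itv/= in_itv/=.
by have := yab j; rewrite !mxE => /andP[? ?]; apply/andP; split; lra.
Qed.

Lemma measurable_half_space (i0 : 'I_n) (t : R) :
  measurable ([set x | x ord0 i0 < t] : set X).
Proof.
apply: sub_sigma_algebra.
rewrite [X in open X](_ : _ = (fun x : 'rV[R]_n => x ord0 i0) @^-1` `]-oo, t[%classic).
  apply: open_comp; last exact: lray_open.
  by move=> x _; exact: coord_continuous.
by apply/seteqP; split=> x /=; rewrite in_itv.
Qed.

(** The measure of the part of [Q] below the hyperplane [x i0 = t] is a Lipschitz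
    function of [t], so it takes the value [w]. *)
Lemma lebesgue_rV_split (Q : set X) (w : R) : (0 < n)%N ->
  measurable Q -> bounded_set (Q : set 'rV[R]_n) ->
  0 <= w -> (w%:E <= leb Q)%E ->
  exists S : set X, [/\ measurable S, S `<=` Q & leb S = w%:E].
Proof.
move=> n0 mQ bQ w0 wQ; have [M M0 QM] := bounded_set_rV_box bQ.
have Qoo := lebesgue_rV_lty mQ bQ.
pose i0 : 'I_n := Ordinal n0.
pose H t : set X := [set x : 'rV[R]_n | x ord0 i0 < t].
have mQH t : measurable (Q `&` H t).
  by apply: measurableI => //; exact: measurable_half_space.
have QHoo t : (leb (Q `&` H t) < +oo)%E.
  apply: le_lt_trans Qoo; apply: le_measure; rewrite ?inE//.
have QHfin t : leb (Q `&` H t) \is a fin_num by rewrite ge0_fin_numE.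
pose G t : R := fine (leb (Q `&` H t)).
pose L : R := \prod_(i < n | i != i0) (M - - M).
have L0 : 0 <= L by apply: prodr_ge0 => i _; rewrite opprK addr_ge0// ltW.
have GL s t : s <= t -> 0 <= G t - G s <= (t - s) * L.
  move=> st; have QHst : Q `&` H s `<=` Q `&` H t.
    by move=> x [Qx] /= xs; split => //; exact: lt_le_trans xs st.
  have -> : G t - G s = fine (leb ((Q `&` H t) `\` (Q `&` H s))).
    have QHI : Q `&` H t `&` (Q `&` H s) = Q `&` H s.
      by rewrite setIC; exact/setIidPl.
    rewrite (measureD (mQH t) (mQH s) (QHoo t)) [in RHS]QHI.
    by rewrite fineB ?QHfin.
  rewrite fine_ge0//= -lee_fin fineK; last first.
    rewrite ge0_fin_numE//; apply: le_lt_trans (QHoo t).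
    by apply: le_measure; rewrite ?inE//; exact: measurableD.
  pose a : 'rV[R]_n := \row_i if i == i0 then s else - M.
  pose b : 'rV[R]_n := \row_i if i == i0 then t else M.
  have -> : (((t - s) * L)%:E = leb (rV_box a b))%E.
    rewrite lebesgue_rV_box => [|i]; last first.
      by rewrite !mxE; case: ifP => // _; lra.
    congr (_%:E); rewrite (bigD1 i0)//= !mxE eqxx; congr (_ * _).
    by apply: eq_bigr => i /negPf ii0; rewrite !mxE ii0.
  apply: le_measure; rewrite ?inE; [exact: measurableD|exact: measurable_rV_box|].
  move=> x [[Qx /= xt] xs] i; rewrite !mxE; case: eqP => [->|_].
    apply/andP; split; last exact: ltW.
    by rewrite leNgt; apply/negP => xs'; exact: xs.
  by have := QM _ Qx i; rewrite !mxE.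
have cG : continuous G.
  move=> t; apply/cvgrPdist_le => e e0; near=> s.
  have Ge : `|G t - G s| <= `|t - s| * L.
    have [st|/ltW ts] := leP s t.
      have /andP[? ?] := GL _ _ st.
      by rewrite !ger0_norm// subr_ge0.
    have /andP[? ?] := GL _ _ ts.
    by rewrite distrC [`|t - s|]distrC !ger0_norm// subr_ge0.
  apply: (le_trans Ge).
  have : `|t - s| <= e / (L + 1).
    by near: s; apply: cvgr_dist_le; [exact: cvg_id|rewrite divr_gt0// ltr_wpDl].
  rewrite ler_pdivlMr ?ltr_wpDl// => /(le_trans _); apply.
  by rewrite ler_wpM2l// lerDl.
have G0 : G (- M) = 0.
  rewrite /G (_ : Q `&` H (- M) = set0) ?measure0//.
  apply/seteqP; split=> // x [Qx /=]; rewrite /H/= => xM.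
  by have := QM _ Qx i0; rewrite !mxE leNgt xM.
have G1 : (G (M + 1))%:E = leb Q.
  rewrite /G fineK// (_ : Q `&` H (M + 1) = Q)//.
  apply/setIidPl => x Qx /=; have := QM _ Qx i0; rewrite !mxE => /andP[_ ?].
  by rewrite /H/=; lra.
have MM : - M <= M + 1 by lra.
have [|t _ Gt] := @IVT _ G (- M) (M + 1) w MM (continuous_subspaceT cG).
- rewrite G0 ge_min w0/= le_max orbC; apply/orP; left.
  by rewrite -lee_fin G1.
- by exists (Q `&` H t); split=> //; rewrite -Gt fineK.
Unshelve. all: by end_near. Qed.

End lebesgue_rV_facts.

(** * Sampling a kernel by a map *)

Section finite_fibers.
Context {R : realType} d (T : measurableType d) (L : finType).
Local Open Scope ereal_scope.

(** Only finite additivity is required of [m], for the sake of set functions that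
    are integrals over a varying domain. *)
Lemma additive_fibers (m : set T -> \bar R) (g : T -> L) (B : set T)
    (P : pred L) :
  m set0 = 0 ->
  (forall A A' : set T, measurable A -> measurable A' -> A `&` A' = set0 ->
     m (A `|` A') = m A + m A') ->
  (forall l, measurable (B `&` [set x | g x = l])) ->
  measurable (B `&` [set x | P (g x)]) /\
  m (B `&` [set x | P (g x)]) = \sum_(l | P l) m (B `&` [set x | g x = l]).
Proof.
move=> m0 mU mB.
have H (s : seq L) : uniq s -> measurable (B `&` [set x | g x \in s]) /\
    m (B `&` [set x | g x \in s]) = \sum_(l <- s) m (B `&` [set x | g x = l]).
  elim: s => [_|l s IH /=/andP[ls /IH[mBs Bs]]].
    rewrite (_ : _ `&` _ = set0) ?big_nil//.
    by apply/seteqP; split=> // x [].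
  have -> : B `&` [set x | g x \in l :: s] =
      (B `&` [set x | g x = l]) `|` (B `&` [set x | g x \in s]).
    apply/seteqP; split=> [x [Bx /=]|x [[Bx /= ->]|[Bx /= gs]]].
    - by rewrite inE => /orP[/eqP|]; [left|right].
    - by rewrite inE eqxx.
    - by rewrite inE gs orbT.
  split; first exact: measurableU.
  rewrite mU// ?big_cons ?Bs//.
  by apply/seteqP; split=> // x [[_ /= gl] [_ /=]]; rewrite gl (negbTE ls).
have [mBP BP] := H (enum P) (enum_uniq _).
have E : [set x | g x \in enum P] = [set x | P (g x)].
  by apply/seteqP; split => x /=; rewrite mem_enum.
by move: mBP BP; rewrite E big_enum.
Qed.

End finite_fibers.

(** A set is divisible for a measure when each of its measurable subsets has
    measurable parts of every smaller measure. *)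
Definition divisible {R : realType} d (T : measurableType d)
    (mu : set T -> \bar R) (D : set T) :=
  forall (Q : set T) (w : R), measurable Q -> Q `<=` D ->
    0 <= w -> (w%:E <= mu Q)%E ->
    exists S : set T, [/\ measurable S, S `<=` Q & mu S = w%:E].

Section sampling.
Context {R : realType} d (T : measurableType d) (mu : {measure set T -> \bar R}).
Context d' (Y : measurableType d').
Variables (D : set T) (A : set Y) (a0 : Y).
Hypotheses (mD : measurable D) (Doo : (mu D < +oo)%E) (divD : divisible mu D).
Hypotheses (mA : measurable A) (Aa0 : A a0).
Local Open Scope ereal_scope.

Let subD_lty Q : measurable Q -> Q `<=` D -> mu Q < +oo.
Proof. by move=> mQ QD; apply: le_lt_trans Doo; apply: le_measure; rewrite ?inE. Qed.

(** A map with prescribed masses: the image of the restriction of [mu] to [Q]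
    under [u] is the discrete measure with mass [p.1] at [p.2] for [p] in [r]. *)
Lemma simple_map (r : seq (R * Y)) (Q : set T) : measurable Q -> Q `<=` D ->
  (forall p, p \in r -> (0 <= p.1)%R) -> (forall p, p \in r -> A p.2) ->
  mu Q = (\sum_(p <- r) p.1)%:E ->
  exists u : T -> Y, (forall x, A (u x)) /\ forall C : set Y,
    measurable (Q `&` u @^-1` C) /\
    mu (Q `&` u @^-1` C) = (\sum_(p <- r | p.2 \in C) p.1)%:E.
Proof.
elim: r Q => [|[w a] r IH] Q mQ QD r0 rA muQ.
  exists (cst a0); split=> // C; rewrite big_nil.
  move: muQ; rewrite big_nil preimage_cst => muQ.
  by case: ifP => _; rewrite ?setIT ?setI0 ?measure0.
have w0 : (0 <= w)%R by apply: (r0 (w, a)); rewrite inE eqxx.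
have r1 p : p \in r -> (0 <= p.1)%R by move=> pr; apply: r0; rewrite inE pr orbT.
have rA1 p : p \in r -> A p.2 by move=> pr; apply: rA; rewrite inE pr orbT.
rewrite big_cons/= in muQ.
have wQ : w%:E <= mu Q.
  by rewrite muQ lee_fin lerDl big_seq; apply: sumr_ge0 => p /r1.
have [S [mS SQ muS]] := divD mQ QD w0 wQ.
have mQS : measurable (Q `\` S) by exact: measurableD.
have [||u [uA uP]] := IH _ mQS _ r1 rA1.
  by move=> x [/QD].
  transitivity (mu Q - mu S); last by rewrite muQ muS -EFinB addrC addKr.
  rewrite measureD//; last exact: subD_lty.
  by congr (_ - mu _); exact/setIidPr.
exists (fun x => if x \in S then a else u x); split=> [x|C].
  by case: ifP => // _; apply: (rA (w, a)); rewrite inE eqxx.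
have [mC muC] := uP C.
have -> : Q `&` (fun x => if x \in S then a else u x) @^-1` C =
    (if a \in C then S else set0) `|` ((Q `\` S) `&` u @^-1` C).
  apply/seteqP; split=> [x [Qx /=]|x].
    case: ifPn => Sx Cx; last first.
      by rewrite notin_setE in Sx; right.
    by left; rewrite mem_set//; exact: set_mem.
  move=> [|[[Qx Sx] /= Cx]]; last by split=> //=; rewrite memNset.
  case: ifPn => // /[!inE] Ca Sx; split=> /=; first exact: SQ.
  by rewrite mem_set.
have mSC : measurable (if a \in C then S else set0) by case: ifP.
split; first exact: measurableU.
rewrite measureU//; last first.
  by apply/seteqP; split=> // x []; case: ifP => // _ Sx [[]].
rewrite [X in _ + X = _]muC big_cons/=; case: ifP => _.
  by rewrite [X in X + _]muS.
by rewrite [X in X + _](measure0 mu) add0e.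
Qed.

Variables (L1 L2 : finType) (e : T -> L1) (c : Y -> L2).
Variable (q : T -> probability Y R).
Hypothesis me : forall l, measurable [set x | e x = l].
Hypothesis mc : forall l, measurable [set y | c y = l].
Hypothesis mq : forall B, measurable B -> measurable_fun setT (fun x => q x B).
Hypothesis qA : {ae mu, forall x, D x -> q x A = 1}.

Let mcP (P : pred L2) : measurable [set y | P (c y)].
Proof.
pose m : probability Y R := @dirac _ Y a0 R.
rewrite -[X in measurable X]setTI.
apply: (additive_fibers (m := m) P (measure0 m) _ _).1.
  by move=> B B' mB mB' BB'; exact: measureU.
by move=> l; rewrite setTI.
Qed.

Let integral_lty (Q : set T) (B : set Y) : measurable Q -> Q `<=` D ->
  measurable B -> \int[mu]_(x in Q) q x B < +oo.
Proof.
move=> mQ QD mB; apply: (@le_lt_trans _ _ (\int[mu]_(x in Q) (cst 1) x)).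
  apply: ge0_le_integral => //.
  - by apply: measurable_funTS; exact: mq.
  - by move=> x _; exact: probability_le1.
by rewrite integral_cst// mul1e subD_lty.
Qed.

(** For maps [e] and [c] with finitely many values, the joint law of [e x] and
    [c (u x)] under [mu] is the one that the kernel [q] prescribes. *)
Lemma sampling : exists u : T -> Y,
  [/\ forall x, A (u x), forall B : set Y, measurable (D `&` u @^-1` B) &
  forall (P1 : pred L1) (P2 : pred L2),
    mu (D `&` [set x | P1 (e x) /\ P2 (c (u x))]) =
    \int[mu]_(x in D `&` [set x | P1 (e x)]) q x [set y | P2 (c y)] ].
Proof.
pose Q l := D `&` [set x | e x = l].
have mQ l : measurable (Q l) by exact: measurableI.
have QD l : Q l `<=` D by move=> x [].
pose W l l' : \bar R := \int[mu]_(x in Q l) q x [set y | c y = l'].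
have W0 l l' : 0 <= W l l' by apply: integral_ge0.
have Woo l l' : W l l' \is a fin_num by rewrite ge0_fin_numE// integral_lty.
(* a point of A in each cell of c that meets A *)
have /choice[rep repP] (l' : L2) : exists a : Y, A a /\
    ((exists2 y, A y & c y = l') -> c a = l').
  have [[y Ay cy]|H] := pselect (exists2 y, A y & c y = l').
    by exists y.
  by exists a0; split.
(* a cell that misses A has mass 0 *)
have repW l l' : c (rep l') <> l' -> W l l' = 0.
  move=> cl; rewrite /W.
  transitivity (\int[mu]_(x in Q l) (cst 0 x : \bar R)); last exact: integral0.
  apply: ge0_ae_eq_integral => //.
    by apply: measurable_funTS; exact: mq.
  move: qA; apply: filterS => x qxA [Dx _].
  apply/eqP; rewrite eq_le measure_ge0 andbT.
  apply: (@le_trans _ _ (q x (~` A))).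
    apply: le_measure; rewrite ?inE//; first exact: measurableC.
    move=> y /= cy Ay; apply: cl; apply: (repP l').2; by exists y.
  by rewrite probability_setC// qxA// subee.
have additive_int (l : L1) (P : pred L2) :
    \int[mu]_(x in Q l) q x [set y | P (c y)] = \sum_(l' | P l') W l l'.
  transitivity (\int[mu]_(x in Q l)
      \sum_(l' <- enum P) q x [set y | c y = l']); last first.
    rewrite ge0_integral_sum//; last by move=> l'; apply: measurable_funTS; exact: mq.
    by rewrite big_enum.
  apply: eq_integral => x _; rewrite big_enum/=.
  have [_] := additive_fibers (m := q x) (g := c) (B := setT) P (measure0 (q x))
    (fun B B' mB mB' BB' => measureU (q x) mB mB' BB')
    (fun l' => measurableI _ _ measurableT (mc l')).
  rewrite setTI => ->; apply: eq_bigr => l' _; by rewrite setTI.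
have WQ l : \sum_l' W l l' = mu (Q l).
  rewrite -(additive_int l predT) -[RHS]mul1e -integral_cst//.
  apply: eq_integral => x _.
  have -> : [set y | predT (c y)] = setT by apply/seteqP; split.
  exact: probability_setT.
have /choice[u uP] (l : L1) : exists u : T -> Y, (forall x, A (u x)) /\
    forall B : set Y, measurable (Q l `&` u @^-1` B) /\
    mu (Q l `&` u @^-1` B) = \sum_(l' | rep l' \in B) W l l'.
  have [|||u [uA uP]] := @simple_map
      [seq (fine (W l l'), rep l') | l' <- enum L2] (Q l) (mQ l) (@QD l).
  - by move=> _ /mapP[l' _ ->] /=; exact: fine_ge0.
  - by move=> _ /mapP[l' _ ->] /=; exact: (repP l').1.
  - rewrite big_map big_enum/= -WQ -sumEFin.
    by apply: eq_bigr => l' _; rewrite fineK.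
  exists u; split=> // B; have [? ->] := uP B; split=> //.
  rewrite big_map/= big_enum_cond/= -sumEFin.
  by apply: eq_bigr => l' _; rewrite fineK.
have uE (P1 : pred L1) (B : set Y) :
    measurable (D `&` [set x | P1 (e x) /\ B (u (e x) x)]) /\
    mu (D `&` [set x | P1 (e x) /\ B (u (e x) x)]) =
    \sum_(l | P1 l) \sum_(l' | rep l' \in B) W l l'.
  have QuE l : D `&` [set x | B (u (e x) x)] `&` [set x | e x = l] =
      Q l `&` u l @^-1` B.
    by apply/seteqP; split=> [x [[Dx /= Bu] el]|x [[Dx /= el] Bu]];
      move: Bu; rewrite /Q/= el.
  have [||mU U2] := @additive_fibers R _ _ L1 mu e
    (D `&` [set x | B (u (e x) x)]) P1 (measure0 mu).
  - by move=> *; exact: measureU.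
  - move=> l; rewrite QuE; exact: ((uP l).2 B).1.
  rewrite (_ : D `&` [set x | P1 (e x) /\ B (u (e x) x)] =
      D `&` [set x | B (u (e x) x)] `&` [set x | P1 (e x)]); last first.
    by apply/seteqP; split=> x /=; tauto.
  split=> //; rewrite U2; apply: eq_bigr => l _; rewrite QuE.
  exact: ((uP l).2 B).2.
exists (fun x => u (e x) x); split=> [x|B|P1 P2].
- exact: (uP (e x)).1.
- have [+ _] := uE predT B; congr measurable.
  by apply/seteqP; split=> [x [Dx [_ Bx]]|x [Dx Bx]].
- rewrite (uE P1 [set y | P2 (c y)]).2.
  have mP2 := mcP P2.
  have [|||_ ->] := @additive_fibers R _ _ L1
    (fun Q => \int[mu]_(x in Q) q x [set y | P2 (c y)]) e D P1.
  + by rewrite integral_set0.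
  + move=> B B' mB mB' BB'; rewrite ge0_integral_setU//.
      by apply: measurable_funTS; exact: mq.
    by apply/disj_set2P.
  + by move=> l; exact: mQ.
  apply: eq_bigr => l _; rewrite additive_int big_mkcond [RHS]big_mkcond/=.
  apply: eq_bigr => l' _; have [cl|/eqP/repW ->] := eqVneq (c (rep l')) l'.
    by congr (if _ then _ else _); apply/idP/idP; rewrite inE/= cl.
  by rewrite !if_same.
Qed.

End sampling.

(** * Weak-star convergence tested on a generating class *)

Section weak_star.
Context {R : realType} d (T : measurableType d) (mu : {measure set T -> \bar R}).
Variables (D : set T) (g : nat -> T -> R) (M : R).
Hypotheses (mD : measurable D) (Doo : (mu D < +oo)%E).
Hypothesis mg : forall j, measurable_fun D (g j).
Hypothesis gM : forall j x, D x -> `|g j x| <= M.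

Lemma bounded_integrable (h : T -> R) (N : R) : measurable_fun D h ->
  (forall x, D x -> `|h x| <= N) -> mu.-integrable D (EFin \o h).
Proof.
move=> mh hN; apply: measurable_bounded_integrable => //.
exists N; split; first exact: num_real.
by move=> K NK x Dx; exact: le_trans (hN _ Dx) (ltW NK).
Qed.

Lemma integrable_mulg j (h : T -> R) : mu.-integrable D (EFin \o h) ->
  mu.-integrable D (EFin \o (fun x => h x * g j x)).
Proof.
move=> ih; rewrite (_ : _ \o _ = ((EFin \o h) \* (EFin \o g j))%E); last first.
  by apply/funext => x /=; rewrite EFinM.
apply: integrableMl => //.
exists M; split; first exact: num_real.
by move=> K NK x Dx; exact: le_trans (gM _ Dx) (ltW NK).
Qed.

(** [h] is integrable and its products with the sequence [g] have integrals that
    tend to [0]. *)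
Let null (h : T -> R) := mu.-integrable D (EFin \o h) /\
  \int[mu]_(x in D) (h x * g j x) @[j --> \oo] --> (0 : R).

Let nullD h1 h2 (a : R) : null h1 -> null h2 -> null (fun x => a * h1 x + h2 x).
Proof.
move=> [i1 n1] [i2 n2].
have i3 : mu.-integrable D (EFin \o (fun x => a * h1 x)).
  rewrite (_ : _ \o _ = (fun x => a%:E * (EFin \o h1) x)%E); first exact: integrableZl.
  by apply/funext => x /=; rewrite EFinM.
split.
  rewrite (_ : _ \o _ = ((EFin \o (fun x => a * h1 x)%R) \+ (EFin \o h2))%E).
    exact: integrableD.
  by apply/funext => x /=; rewrite EFinD.
rewrite (_ : (fun j => _) = fun j => a * \int[mu]_(x in D) (h1 x * g j x) +
    \int[mu]_(x in D) (h2 x * g j x)).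
  rewrite [X in _ --> X](_ : 0 = a * 0 + 0); last by rewrite mulr0 addr0.
  by apply: cvgD => //; apply: cvgM => //; exact: cvg_cst.
apply/funext => j; rewrite -RintegralZl//; last exact: integrable_mulg.
rewrite -RintegralD//; last 2 first.
- have := integrable_mulg j i3; congr (_.-integrable _ _).
  by apply/funext => x /=; rewrite mulrA.
- exact: integrable_mulg.
by apply: eq_Rintegral => x _; rewrite mulrDl mulrA.
Qed.

Let null_ext h1 h2 : (forall x, D x -> h1 x = h2 x) -> null h1 -> null h2.
Proof.
move=> h12 [i1 n1]; split.
  by apply: eq_integrable i1 => // x /[!inE] Dx /=; rewrite h12.
apply: cvg_trans n1; apply: near_eq_cvg; apply: nearW => j.
by apply: eq_Rintegral => x /[!inE] Dx; rewrite h12.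
Qed.

(** As [g] is bounded, [null] is closed in L1. *)
Let null_L1 h : mu.-integrable D (EFin \o h) ->
  (forall e : R, 0 < e ->
    exists2 h', null h' & \int[mu]_(x in D) `|h x - h' x| <= e) -> null h.
Proof.
move=> ih H; split=> //; apply/cvgr0Pnorm_le => e e0.
have M0 : 0 <= `|M| + 1 by rewrite addr_ge0.
have [|h' [ih' nh'] hh'] := H (e / 2 / (`|M| + 1)).
  by rewrite !divr_gt0// ltr_wpDl.
have e2 : 0 < e / 2 by rewrite divr_gt0.
have /cvgr0Pnorm_le/(_ _ e2) := nh'; apply: filterS => j h'e.
have iB : mu.-integrable D (EFin \o (fun x => h x - h' x)).
  rewrite (_ : _ \o _ = ((EFin \o h) \- (EFin \o h'))%E).
    exact: integrableB.
  by apply/funext => x /=; rewrite EFinB.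
have -> : \int[mu]_(x in D) (h x * g j x) =
    \int[mu]_(x in D) (h' x * g j x) + \int[mu]_(x in D) ((h x - h' x) * g j x).
  rewrite -RintegralD//; [|exact: integrable_mulg|exact: integrable_mulg].
  by apply: eq_Rintegral => x _; ring.
apply: (le_trans (ler_normD _ _)); rewrite (splitr e) lerD//.
apply: (le_trans (le_normr_Rintegral mD (integrable_mulg j iB))).
have iN : mu.-integrable D (EFin \o (fun x => `|h x - h' x|)) by exact: integrable_norm.
apply: (@le_trans _ _ (\int[mu]_(x in D) (`|h x - h' x| * (`|M| + 1)))).
  apply: le_Rintegral => //.
  - exact/integrable_norm/integrable_mulg.
  - rewrite (_ : _ \o _ = (fun x => (EFin \o (fun x => `|h x - h' x|)%R) x * (`|M| + 1)%:E)%E).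
      exact: integrableZr.
    by apply/funext => x /=; rewrite EFinM.
  - move=> x Dx; rewrite normrM ler_wpM2l// (le_trans (gM _ Dx))//.
    by rewrite (le_trans (ler_norm _))// lerDl.
rewrite RintegralZr//.
by rewrite -ler_pdivlMr// ltr_wpDl.
Qed.

Variable G : set (set T).
Hypotheses (GE : @measurable _ T = <<s G >>) (GI : setI_closed G).
Hypothesis gT : \int[mu]_(x in D) g j x @[j --> \oo] --> (0 : R).
Hypothesis gG : forall B, G B ->
  \int[mu]_(x in D) (\1_B x * g j x) @[j --> \oo] --> (0 : R).

Let int_indic (B : set T) : measurable B -> mu.-integrable D (EFin \o \1_B).
Proof.
move=> mB; apply: (@bounded_integrable _ 1) => //.
by move=> x _; rewrite indicE; case: (_ \in _); rewrite ?normr1 ?normr0.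
Qed.

Let null_indicT : null (cst 1).
Proof.
split; first by apply: (@bounded_integrable _ 1) => // x _; rewrite normr1.
apply: cvg_trans gT; apply: near_eq_cvg; apply: nearW => j.
by apply: eq_Rintegral => x _; rewrite mul1r.
Qed.

Let null_indic B : measurable B -> null \1_B.
Proof.
move=> mB; apply: (@dynkin_induction _ T G (fun B => null \1_B)) => //.
- by apply: null_ext null_indicT => x _; rewrite indicT.
- move=> B' GB'; split; last exact: gG.
  by apply: int_indic; rewrite GE; exact: sub_sigma_algebra.
- move=> S mS nS; have := nullD (-1) nS null_indicT; apply: null_ext => x _.
  by rewrite !indicE in_setC /=; case: (_ \in _); rewrite /= ?mulr1 ?mulr0; lra.
- move=> F mF tF nF.
  pose U n := \big[setU/set0]_(i < n) F i.
  have mU n : measurable (U n) by exact: bigsetU_measurable.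
  have mUF : measurable (\bigcup_k F k) by exact: bigcup_measurable.
  have UF n : U n `<=` \bigcup_k F k by exact: bigsetU_bigcup.
  have nU n : null \1_(U n).
    elim: n => [|n IH].
      have := nullD (-1) null_indicT null_indicT; apply: null_ext => x _.
      by rewrite /U big_ord0 indic0 /= mulr1 addNr.
    have := nullD 1 (nF n) IH; apply: null_ext => x _.
    rewrite /U big_ord_recr/= mul1r !indicE in_setU.
    have [Fx|Fx] := boolP (x \in F n); have [Ux|Ux] := boolP (x \in _) => //=;
      rewrite ?addr0 ?add0r//.
    move: Ux; rewrite inE -bigcup_mkord => -[i /= ilt Fix].
    have /(_ I I) in_ := tF i n.
    have : i = n by apply: in_; exists x; split=> //; exact: set_mem.
    by move=> E; rewrite E ltnn in ilt.
  apply: null_L1 => [|e e0]; first exact: int_indic.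
  have intE C : measurable C -> \int[mu]_(x in D) \1_C x = fine (mu (C `&` D)).
    by move=> mB'; rewrite /Rintegral integral_indic.
  have fB C : measurable C -> mu (C `&` D) \is a fin_num.
    move=> mB'; rewrite ge0_fin_numE//; apply: le_lt_trans Doo.
    by apply: le_measure; rewrite ?inE//; exact: measurableI.
  have cU : mu (U n `&` D) @[n --> \oo] --> mu ((\bigcup_k F k) `&` D).
    rewrite (_ : (\bigcup_k F k) `&` D = \bigcup_n (U n `&` D)); last first.
      rewrite -setI_bigcupl; congr (_ `&` _).
      apply/seteqP; split=> [x [k _ Fx]|x [k _ Ux]]; last exact: UF Ux.
      by exists k.+1 => //; rewrite /U big_ord_recr; right.
    apply: nondecreasing_cvg_mu => //.
    - by move=> n; exact: measurableI.
    - by apply: bigcup_measurable => n _; exact: measurableI.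
    - move=> a b ab; apply/subsetPset; apply: setSI.
      by apply: subset_bigsetU.
  have cU' : fine (mu (U n `&` D)) @[n --> \oo] --> fine (mu ((\bigcup_k F k) `&` D)).
    by apply: fine_cvg; rewrite fineK// fB.
  have /cvgrPdist_le /(_ _ e0)[N _ /(_ N (leqnn _))/= HN] := cU'.
  exists \1_(U N) => //; apply: le_trans HN.
  rewrite -!intE// -RintegralB//; [|exact: int_indic|exact: int_indic].
  apply: (le_trans _ (ler_norm _)); rewrite le_eqVlt; apply/orP; left; apply/eqP.
  apply: eq_Rintegral => x _; rewrite ger0_norm// subr_ge0 !indicE ler_nat.
  have [/set_mem/UF/mem_set ->|] := boolP (x \in U N) => //.
- by rewrite -GE.
Qed.

Import HBSimple.

(** A bounded sequence whose integrals tend to [0] on the sets of a pi-system that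
    generates the sigma-algebra, and on the whole of [D], tends to [0] against
    every integrable function. *)
Lemma weak_star (h : T -> R) : mu.-integrable D (EFin \o h) ->
  \int[mu]_(x in D) (h x * g j x) @[j --> \oo] --> (0 : R).
Proof.
move=> ih; suff : null h by case.
apply: null_L1 => // e e0.
have [s [is_ _ sh]] := approximation_sfun_integrable mD ih.
have /fine_cvgP[sfin] := sh.
move/cvgr0Pnorm_le => /(_ _ e0) [k _ kP].
exists (s k : T -> R); last first.
  apply: le_trans (kP k (leqnn _)); rewrite ger0_norm; last first.
    by rewrite fine_ge0// integral_ge0.
  rewrite le_eqVlt; apply/orP; left; apply/eqP; congr fine.
have H (r : seq R) : null (fun x => \sum_(y <- r) y * \1_(s k @^-1` [set y]) x).
  elim: r => [|y r IH].
    have := nullD (-1) null_indicT null_indicT; apply: null_ext => x _.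
    by rewrite big_nil /= mulr1 addNr.
  have := nullD y (null_indic (measurable_sfunP (s k) (measurable_set1 y))) IH.
  by apply: null_ext => x _; rewrite big_cons.
have Hk := H (finmap.enum_fset (fset_set (range (s k : T -> R)))).
apply: null_ext Hk => x _.
by rewrite [RHS]fimfunE fsbig_finite.
Qed.

End weak_star.

(** * Integrals and null sets on a square *)

Section square_domain.
Context {R : realType} d (T : measurableType d).
Variable mu : {sigma_finite_measure set T -> \bar R}.
Local Open Scope ereal_scope.
Local Notation mu2 := (mu \x mu).

Lemma ge0_integral_setX (E F : set T) (G : T * T -> \bar R) :
  measurable E -> measurable F -> measurable_fun setT G -> (forall z, 0 <= G z) ->
  \int[mu2]_(z in E `*` F) G z = \int[mu]_(x in E) \int[mu]_(y in F) G (x, y).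
Proof.
move=> mE mF mG G0; rewrite integral_mkcond fubini_tonelli1; last 2 first.
- apply/(measurable_restrictT _ (measurableX mE mF)).
  exact: measurable_funTS.
- by move=> z; apply: erestrict_ge0 => z' _; exact: G0.
rewrite [RHS]integral_mkcond; apply: eq_integral => x _.
rewrite /fubini_F patchE; case: ifPn => xE.
  rewrite [RHS]integral_mkcond; apply: eq_integral => y _.
  by rewrite !patchE in_setX xE.
transitivity (\int[mu]_y (cst 0 y : \bar R)); last exact: integral0.
by apply: eq_integral => y _; rewrite patchE in_setX (negbTE xE).
Qed.

Lemma integral_setX_mul (E F : set T) (f g : T -> \bar R) :
  measurable E -> measurable F ->
  measurable_fun E f -> measurable_fun F g ->
  (forall x, E x -> 0 <= f x) -> (forall y, F y -> 0 <= g y) ->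
  \int[mu2]_(z in E `*` F) (f z.1 * g z.2) =
  \int[mu]_(x in E) f x * \int[mu]_(y in F) g y.
Proof.
move=> mE mF mf mg f0 g0.
pose f' := f \_ E; pose g' := g \_ F.
have mf' : measurable_fun setT f' by apply/(measurable_restrictT _ mE).
have mg' : measurable_fun setT g' by apply/(measurable_restrictT _ mF).
have f'0 x : 0 <= f' x by apply: erestrict_ge0.
have g'0 x : 0 <= g' x by apply: erestrict_ge0.
have f'E x : E x -> f x = f' x by move=> Ex; rewrite /f' patchE mem_set.
have g'F x : F x -> g x = g' x by move=> Fx; rewrite /g' patchE mem_set.
transitivity (\int[mu2]_(z in E `*` F) (f' z.1 * g' z.2)).
  by apply: eq_integral => z /[!inE] -[Ez Fz]; rewrite f'E// g'F.
rewrite ge0_integral_setX//=; last 2 first.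
- by apply: emeasurable_funM; apply: measurableT_comp => //; exact: measurable_snd.
- by move=> z; rewrite mule_ge0.
have gE : \int[mu]_(y in F) g y = \int[mu]_(y in F) g' y.
  by apply: eq_integral => y /[!inE] Fy; rewrite g'F.
transitivity (\int[mu]_(x in E) (f' x * \int[mu]_(y in F) g' y)).
  apply: eq_integral => x _ /=; apply: ge0_integralZl => //.
  exact: measurable_funTS.
rewrite ge0_integralZr//; last 2 first.
- exact: measurable_funTS.
- by apply: integral_ge0.
rewrite gE; congr (_ * _).
by apply: eq_integral => y /[!inE] Ey; rewrite f'E.
Qed.

Lemma setX_lty (D : set T) : measurable D -> mu D < +oo ->
  mu2 (D `*` D) < +oo.
Proof. by move=> mD Doo; rewrite product_measure1E// lte_mul_pinfty// ge0_fin_numE. Qed.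

Lemma ae_setX_fst (D : set T) (P : T -> Prop) : measurable D -> 0 < mu D ->
  {ae mu2, forall z, (D `*` D) z -> P z.1} -> {ae mu, forall x, D x -> P x}.
Proof.
move=> mD D0 [N [mN N0 PN]].
have mG := measurable_fun_xsection mu mN.
have G0 : \int[mu]_x mu (xsection N x) = 0 by exact: N0.
have : ae_eq mu setT (mu \o xsection N) (cst 0).
  apply/(ae_eq_integral_abs _ measurableT) => //.
  by rewrite -[RHS]G0; apply: eq_integral => x _; rewrite gee0_abs.
apply: filterS => x /(_ I)/= Nx0 Dx; apply: contrapT => nP.
have : mu D <= mu (xsection N x).
  apply: le_measure; rewrite ?inE//; first exact: measurable_xsection.
  by move=> y Dy; rewrite /xsection/= inE; apply: PN => /= /(_ (conj Dx Dy)).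
by rewrite [X in _ <= X -> _]Nx0 leNgt D0.
Qed.

Lemma ae_setX (D : set T) (P Q : T -> Prop) :
  {ae mu, forall x, D x -> P x} -> {ae mu, forall x, D x -> Q x} ->
  {ae mu2, forall z, (D `*` D) z -> P z.1 /\ Q z.2}.
Proof.
move=> [N [mN N0 PN]] [N' [mN' N'0 QN]].
have H1 : {ae mu2, forall z, (D `*` D) z -> P z.1}.
  exists (N `*` setT); split; first exact: measurableX.
    by rewrite product_measure1E// [X in X * _]N0 mul0e.
  move=> z /= H; split=> //; apply: PN => /= H'; apply: H => -[Dz _].
  exact: H'.
have H2 : {ae mu2, forall z, (D `*` D) z -> Q z.2}.
  exists (setT `*` N'); split; first exact: measurableX.
    by rewrite product_measure1E// [X in _ * X]N'0 mule0.
  move=> z /= H; split=> //; apply: QN => /= H'; apply: H => -[_ Dz].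
  exact: H'.
by apply: filterS2 H1 H2 => z h1 h2 Dz; split; [exact: h1|exact: h2].
Qed.

End square_domain.

Lemma ae_forall_countable {R : realType} d (T : measurableType d) (I : countType)
    (mu : {measure set T -> \bar R}) (P : I -> T -> Prop) :
  (forall i, {ae mu, forall x, P i x}) -> {ae mu, forall x, forall i, P i x}.
Proof.
move=> H.
have : {ae mu, forall x, forall k : nat,
    if unpickle k is Some i then P i x else True}.
  apply: ae_foralln => k; case: (unpickle k) => [i|]; first exact: H.
  exact: aeW.
by apply: filterS => x Px i; have := Px (pickle i); rewrite pickleK.
Qed.

Section rectangles.
Context {R : realType} d (T : measurableType d).
Variable mu : {sigma_finite_measure set T -> \bar R}.
Local Open Scope ereal_scope.
Local Notation mu2 := (product_measure1 mu mu).

(** Functions with the same integrals over the rectangles contained in [D `*` D]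
    agree almost everywhere there. *)
Lemma integral_rect_ae_eq (D : set T) (G1 G2 : T * T -> \bar R) :
  measurable D ->
  measurable_fun setT G1 -> measurable_fun setT G2 ->
  (forall z, 0 <= G1 z) -> (forall z, 0 <= G2 z) ->
  \int[mu2]_(z in D `*` D) G1 z < +oo ->
  (forall E F, measurable E -> measurable F -> E `<=` D -> F `<=` D ->
    \int[mu2]_(z in E `*` F) G1 z = \int[mu2]_(z in E `*` F) G2 z) ->
  ae_eq mu2 (D `*` D) G1 G2.
Proof.
move=> mD mG1 mG2 G10 G20 G1oo H.
have mDD : measurable (D `*` D) by exact: measurableX.
apply: integral_ae_eq => //.
- apply/integrableP; split; first exact: measurable_funTS.
  by under eq_integral do rewrite gee0_abs//.
- exact: measurable_funTS.
move=> B BD mB; rewrite -(setIidr BD).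
pose P (B : set (T * T)) :=
  \int[mu2]_(z in D `*` D `&` B) G1 z = \int[mu2]_(z in D `*` D `&` B) G2 z.
apply: (@dynkin_induction _ (T * T)%type
  [set A `*` A' | A in measurable & A' in measurable] P).
- exact: measurable_prod_measurableType.
- move=> _ _ [A mA [A' mA' <-]] [A1 mA1 [A1' mA1' <-]].
  exists (A `&` A1); first exact: measurableI.
  by exists (A' `&` A1'); [exact: measurableI|rewrite setXI].
- by rewrite /P setIT; exact: H.
- move=> _ [A mA [A' mA' <-]]; rewrite /P -setXI.
  by apply: H => //; exact: measurableI.
- move=> S mS PS.
  have U (G : T * T -> \bar R) : measurable_fun setT G -> (forall z, 0 <= G z) ->
      \int[mu2]_(z in D `*` D) G z = \int[mu2]_(z in D `*` D `&` S) G z +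
        \int[mu2]_(z in D `*` D `&` ~` S) G z.
    move=> mG G0; rewrite -ge0_integral_setU//.
    + by rewrite -setIUr setUv setIT.
    + exact: measurableI.
    + by apply: measurableI => //; exact: measurableC.
    + exact: measurable_funTS.
    + by apply/disj_set2P; rewrite setIACA setICr setI0.
  have fin : \int[mu2]_(z in D `*` D `&` S) G1 z \is a fin_num.
    rewrite ge0_fin_numE ?integral_ge0//; apply: le_lt_trans G1oo.
    apply: ge0_subset_integral => //; first exact: measurableI.
    exact: measurable_funTS.
  have := H _ _ mD mD (@subset_refl _ D) (@subset_refl _ D).
  rewrite (U G1)// (U G2)// -PS => E12.
  have K x : \int[mu2]_(z in D `*` D `&` S) G1 z + x -
      \int[mu2]_(z in D `*` D `&` S) G1 z = x.
    by rewrite [X in X - _]addeC addeK.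
  by rewrite /P -[LHS]K E12 K.
- move=> F mF tF PF; rewrite /P setI_bigcupr.
  rewrite !ge0_integral_bigcup//; first by apply: eq_eseriesr => k _; exact: PF.
  + by move=> k; exact: measurableI.
  + exact: measurable_funTS.
  + exact: trivIset_setIl.
  + by move=> k; exact: measurableI.
  + exact: measurable_funTS.
  + exact: trivIset_setIl.
- by rewrite -measurable_prod_measurableType.
Qed.

End rectangles.

(** * Limits of nonlocal fields *)

Lemma ecvgn_unique {R : realType} (w : nat -> \bar R) (x y : \bar R) :
  w @ \oo --> x -> w @ \oo --> y -> x = y.
Proof. by move=> wx wy; apply: (cvg_unique _ wx wy); exact: ereal_hausdorff. Qed.

Section limit_measure.
Context {R : realType} d (T : measurableType d).
Variable mu : {sigma_finite_measure set T -> \bar R}.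
Context {V : normedModType R} {I : countType}.
Variables (C : I -> set V) (f : I -> nat -> V -> R).
Hypothesis Cf : bump_base C f.
Variable D : set T.
Hypotheses (mD : measurable D) (Doo : (mu D < +oo)%E) (D0 : (0 < mu D)%E).
Local Open Scope ereal_scope.
Local Notation mu2 := (product_measure1 mu mu).
Local Notation VV := (V * V)%type.

Variables (Lam : T * T -> {charge set (borel VV) -> \bar R})
  (u : nat -> T -> borel V) (lam : T * T -> probability (borel VV) R).
Hypothesis LamP : Linfw_Pr mu2 (D `*` D) Lam.
Hypothesis mu_ : forall l, measurable_fun D (u l).
Hypothesis uLam : generates_YM mu2 (D `*` D) (fun l z => (u l z.1 : V, u l z.2 : V)) Lam.
Hypothesis mlam : forall B, measurable B -> measurable_fun setT (fun z => lam z B).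
Hypothesis Lamlam : {ae mu2, forall z, (D `*` D) z -> charge_eq (Lam z) (lam z)}.

Let f01 i k x : (0 <= f i k x <= 1)%R.
Proof. by have [_ _ _ _ /(_ i)[_ _ + _ _]] := Cf; exact. Qed.

Let f_ge0 i k x : (0 <= f i k x)%R.
Proof. by have /andP[] := f01 i k x. Qed.

Let f_out i k x : ~ C i x -> f i k x = 0%R.
Proof.
move=> nC; have [_ _ _ _ /(_ i)[_ _ _ nd lf]] := Cf.
apply/eqP; rewrite eq_le f_ge0 andbT.
have := lf x; rewrite indicE memNset//= => fl.
have cf : cvgn (f i ^~ x) by apply/cvg_ex; eexists; exact: fl.
apply: (le_trans (nondecreasing_cvgn_le (nd x) cf k)).
by rewrite (cvg_lim _ fl).
Qed.

Let mf i k : measurable_fun setT (f i k : borel V -> R).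
Proof.
apply: measurable_continuous_borel; have [_ _ _ _ /(_ i)[sf _ _ _ _]] := Cf.
exact: smooth_continuous.
Qed.

(** The tensor bump function of [C i `*` C j]. *)
Let phi i j k (w : VV) : R := (f i k w.1 * f j k w.2)%R.

Let phi_ge0 i j k w : (0 <= phi i j k w)%R.
Proof. by rewrite mulr_ge0. Qed.

Let mphi i j k : measurable_fun setT (phi i j k : borel VV -> R).
Proof.
apply: measurable_continuous_borel.
have [_ _ _ _ /(_ (i, j))[sf _ _ _ _]] := bump_base_pair Cf Cf.
exact: smooth_continuous (sf k).
Qed.

(** The integral of that function against [lam z]. *)
Let Psi i j k z : \bar R := \int[lam z]_w (phi i j k w)%:E.

Let Psi_ge0 i j k z : 0 <= Psi i j k z.
Proof. by apply: integral_ge0 => w _; rewrite lee_fin. Qed.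

Let mPsi i j k : measurable_fun setT (Psi i j k).
Proof.
apply: (@measurable_fun_integral_kernel _ _ _ _ _ (fun z => lam z)) => //.
- by move=> w; rewrite lee_fin.
- exact/measurable_EFinP.
Qed.

(** [a] is a factor of the approximants, [t] the limit of [a l i k E * a l j k F]
    in [l], and [s] the limit of [t] in [k]. *)
Let a l i k (E : set T) : \bar R := \int[mu]_(x in E) (f i k (u l x))%:E.
Let t i j k (E F : set T) : \bar R := \int[mu2]_(z in E `*` F) Psi i j k z.
Let s i j (E F : set T) : \bar R := \int[mu2]_(z in E `*` F) lam z (C i `*` C j).

Let integral_indicM d' (T' : measurableType d') (m : {measure set T' -> \bar R})
    (B D' : set T') (g : T' -> \bar R) : B `<=` D' ->
  \int[m]_(x in D') ((\1_B x)%:E * g x) = \int[m]_(x in B) g x.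
Proof.
move=> BD; rewrite -(setIidr BD) [RHS]integral_mkcondr.
apply: eq_integral => x _; rewrite patchE indicE.
by rewrite setIidr//; case: (x \in B); rewrite ?mul1e ?mul0e.
Qed.

Let a_cvg i j k E F : measurable E -> measurable F -> E `<=` D -> F `<=` D ->
  a l i k E * a l j k F @[l --> \oo] --> t i j k E F.
Proof.
move=> mE mF ED FD.
have EFD : E `*` F `<=` D `*` D by move=> z [/ED ? /FD].
have mEF : measurable (E `*` F) by exact: measurableX.
have mDD : measurable (D `*` D) by exact: measurableX.
have ih : mu2.-integrable (D `*` D) (EFin \o \1_(E `*` F)).
  apply: (@bounded_integrable _ _ _ mu2 _ mDD (setX_lty mD Doo) _ 1%R) => //.
  by move=> z _; rewrite indicE; case: (_ \in _); rewrite ?normr1 ?normr0.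
have := uLam ih (bump_C0 (bump_base_pair Cf Cf) (i, j) k).
have -> : \int[mu2]_(z in D `*` D) ((\1_(E `*` F) z)%:E *
    charge_integral (Lam z) (fun w => f i k w.1 * f j k w.2)%R) = t i j k E F.
  rewrite /t -(integral_indicM _ _ EFD); apply: ae_eq_integral => //.
  - apply: emeasurable_funM; first exact/measurable_EFinP.
    exact: LamP.1 _ (bump_C0 (bump_base_pair Cf Cf) (i, j) k).
  - apply: emeasurable_funM; first exact/measurable_EFinP.
    exact: measurable_funTS.
  - by apply: filterS Lamlam => z + Dz => /(_ Dz) zz; rewrite (charge_integralE _ zz).
apply: cvg_trans; apply: near_eq_cvg; apply: nearW => l /=.
rewrite /a -integral_setX_mul//; last 4 first.
- apply/measurable_EFinP; apply: measurableT_comp => //.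
  exact: measurable_funS (mu_ l).
- apply/measurable_EFinP; apply: measurableT_comp => //.
  exact: measurable_funS (mu_ l).
- by move=> x _; rewrite lee_fin.
- by move=> x _; rewrite lee_fin.
by rewrite -(integral_indicM _ _ EFD); apply: eq_integral => z _; rewrite !EFinM.
Qed.

Let s_cvg i j E F : measurable E -> measurable F ->
  t i j k E F @[k --> \oo] --> s i j E F.
Proof.
move=> mE mF.
have mEF : measurable (E `*` F) by exact: measurableX.
have cP := @integral_bump_cvg _ _ _ _ _ (bump_base_pair Cf Cf).
have [_ _ _ _ /(_ (i, j))[_ _ _ nd _]] := bump_base_pair Cf Cf.
rewrite /s (_ : (fun z => _) = fun z => limn (fun k => Psi i j k z)); last first.
  by apply/funext => z; apply/esym/cvg_lim => //; exact: (cP (lam z) (i, j)).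
apply: (@cvg_monotone_convergence _ _ _ mu2 _ mEF (fun k z => Psi i j k z)) => //.
- by move=> k; exact: measurable_funTS.
- move=> z _ k l kl; apply: ge0_le_integral => //.
  + by move=> w _; rewrite lee_fin.
  + exact/measurable_EFinP.
  + exact/measurable_EFinP.
  + by move=> w _; rewrite lee_fin; exact: nd.
Qed.

Let lam_le1 z (B : set (borel VV)) : measurable B -> lam z B <= 1.
Proof. exact: probability_le1. Qed.

Let Psi_le1 i j k z : Psi i j k z <= 1.
Proof.
rewrite -(probability_setT (lam z)) -[leRHS]mul1e -integral_cst//.
apply: ge0_le_integral => //.
- by move=> w _; rewrite lee_fin.
- exact/measurable_EFinP.
- move=> w _; rewrite lee_fin; have /andP[? ?] := f01 i k w.1.
  by have /andP[? ?] := f01 j k w.2; rewrite mulr_ile1.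
Qed.

Let rect_fin (G : T * T -> \bar R) E F : measurable_fun setT G ->
  (forall z, 0 <= G z <= 1) -> measurable E -> measurable F -> E `<=` D -> F `<=` D ->
  \int[mu2]_(z in E `*` F) G z \is a fin_num.
Proof.
move=> mG G01 mE mF ED FD.
have mEF : measurable (E `*` F) by exact: measurableX.
rewrite ge0_fin_numE; last by apply: integral_ge0 => z _; have /andP[] := G01 z.
apply: (@le_lt_trans _ _ (\int[mu2]_(z in E `*` F) cst 1 z)).
  apply: ge0_le_integral => //; first by move=> z _; have /andP[] := G01 z.
    exact: measurable_funTS.
  by move=> z _; have /andP[] := G01 z.
rewrite integral_cst// mul1e; apply: le_lt_trans (setX_lty mD Doo).
by apply: le_measure; rewrite ?inE//; [exact: measurableX|move=> z [/ED ? /FD]].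
Qed.

Let t_fin i j k E F : measurable E -> measurable F -> E `<=` D -> F `<=` D ->
  t i j k E F \is a fin_num.
Proof. by apply: rect_fin => // z; rewrite Psi_ge0 Psi_le1. Qed.

Let s_fin i j E F : measurable E -> measurable F -> E `<=` D -> F `<=` D ->
  s i j E F \is a fin_num.
Proof.
have mC : measurable (C i `*` C j : set (borel VV)).
  by apply: measurableX_borel; exact: (measurable_base Cf).
by apply: rect_fin => [|z]; [exact: mlam|rewrite measure_ge0 lam_le1].
Qed.

(** The factors [a] need not converge, but their products do, and the relation
    [(x y) (z w) = (x w) (z y)] passes to the limit. *)
Let s_exchange i j i' j' E F E' F' : measurable E -> measurable F ->
  E `<=` D -> F `<=` D -> measurable E' -> measurable F' ->
  E' `<=` D -> F' `<=` D ->
  s i j E F * s i' j' E' F' = s i j' E F' * s i' j E' F.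
Proof.
move=> mE mF ED FD mE' mF' ED' FD'.
have tE k : t i j k E F * t i' j' k E' F' = t i j' k E F' * t i' j k E' F.
  pose w1 l := (a l i k E * a l j k F) * (a l i' k E' * a l j' k F').
  pose w2 l := (a l i k E * a l j' k F') * (a l i' k E' * a l j k F).
  have H1 : w1 @ \oo --> t i j k E F * t i' j' k E' F'.
    by apply: cvgeM; [apply: mule_def_fin; exact: t_fin|exact: a_cvg|exact: a_cvg].
  have H2 : w2 @ \oo --> t i j' k E F' * t i' j k E' F.
    by apply: cvgeM; [apply: mule_def_fin; exact: t_fin|exact: a_cvg|exact: a_cvg].
  have w12 : w1 = w2.
    have xyzw (x y z w : \bar R) : (x * y) * (z * w) = (x * w) * (z * y).
      by rewrite [z * w]muleC muleACA [y * z]muleC.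
    by apply/funext => l; exact: xyzw.
  by apply: (ecvgn_unique H1); rewrite w12.
pose w1 k := t i j k E F * t i' j' k E' F'.
pose w2 k := t i j' k E F' * t i' j k E' F.
have H1 : w1 @ \oo --> s i j E F * s i' j' E' F'.
  by apply: cvgeM; [apply: mule_def_fin; exact: s_fin|exact: s_cvg|exact: s_cvg].
have H2 : w2 @ \oo --> s i j' E F' * s i' j E' F.
  by apply: cvgeM; [apply: mule_def_fin; exact: s_fin|exact: s_cvg|exact: s_cvg].
have w12 : w1 = w2 by apply/funext => k; exact: tE.
by apply: (ecvgn_unique H1); rewrite w12.
Qed.

Let s_sym i j E F : measurable E -> measurable F -> E `<=` D -> F `<=` D ->
  s i j E F = s j i F E.
Proof.
move=> mE mF ED FD.
have tE k : t i j k E F = t j i k F E.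
  pose w1 l := a l i k E * a l j k F; pose w2 l := a l j k F * a l i k E.
  have H1 : w1 @ \oo --> t i j k E F by exact: a_cvg.
  have H2 : w2 @ \oo --> t j i k F E by exact: a_cvg.
  have w12 : w1 = w2 by apply/funext => l; exact: muleC.
  by apply: (ecvgn_unique H1); rewrite w12.
pose w1 k := t i j k E F; pose w2 k := t j i k F E.
have H1 : w1 @ \oo --> s i j E F by exact: s_cvg.
have H2 : w2 @ \oo --> s j i F E by exact: s_cvg.
have w12 : w1 = w2 by apply/funext => k; exact: tE.
by apply: (ecvgn_unique H1); rewrite w12.
Qed.

Let c : R := fine (mu D).

Let c0 : (0 < c)%R.
Proof. by rewrite fine_gt0// D0 Doo. Qed.

Let muDE : mu D = c%:E.
Proof. by rewrite fineK// ge0_fin_numE. Qed.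

Let mX (B : set (borel V)) : measurable B ->
  measurable (B `*` setT : set (borel VV)).
Proof. by move=> mB; exact: (measurableX_borel mB measurableT). Qed.

(** The integral over [y] in [D] of the first marginals of [lam (x, y)]. *)
Let marg (B : set (borel V)) x : \bar R :=
  \int[mu]_(y in D) lam (x, y) (B `*` setT).

Let mlam_snd (B : set (borel VV)) x : measurable B ->
  measurable_fun D (fun y => lam (x, y) B).
Proof.
move=> mB; apply: measurable_funTS; apply: (measurableT_comp (mlam mB)).
exact: measurable_pair1.
Qed.

Let marg_ge0 B x : 0 <= marg B x.
Proof. by apply: integral_ge0. Qed.

Let mmarg B : measurable B -> measurable_fun setT (marg B).
Proof.
move=> mB; have mG : measurable_fun setT
    ((fun z => lam z (B `*` setT)) \_ (setT `*` D)).
  apply/(measurable_restrictT _ (measurableX measurableT mD)).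
  by apply: measurable_funTS; apply: mlam; exact: mX.
have := @measurable_fun_fubini_tonelli_F _ _ T T R mu _ mG.
rewrite /fubini_F => H.
rewrite (_ : marg B = fun x =>
    \int[mu]_y ((fun z => lam z (B `*` setT)) \_ (setT `*` D)) (x, y)).
  by apply: H => z; apply: erestrict_ge0.
apply/funext => x; rewrite /marg integral_mkcond; apply: eq_integral => y _.
by rewrite !patchE in_setX in_setT.
Qed.

(** The kernel that averages the first marginals. *)
Let marginal : exists nu : T -> probability (borel V) R,
  forall x B, measurable B -> nu x B = (c^-1)%:E * marg B x.
Proof.
suff H x : exists p : probability (borel V) R,
    forall B, measurable B -> p B = (c^-1)%:E * marg B x.
  by have [nu nuP] := choice H; exists nu => x B; exact: nuP.
pose p (B : set (borel V)) := (c^-1)%:E * marg B x.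
have cV0 : 0 <= (c^-1)%:E by rewrite lee_fin invr_ge0 ltW.
have p0 : p set0 = 0.
  rewrite /p /marg (eq_integral (cst 0)) ?integral0 ?mule0// => y _.
  by rewrite set0X measure0.
have p_ge0 B : 0 <= p B by rewrite mule_ge0.
have ps : semi_sigma_additive p.
  move=> F mF tF mUF.
  have -> : p (\bigcup_k F k) = \sum_(k <oo) p (F k).
    rewrite /p nneseriesZl; last by move=> k _; exact: marg_ge0.
    congr (_ * _); rewrite /marg -integral_nneseries//; last first.
      by move=> k; apply: mlam_snd; exact: mX.
    apply: eq_integral => y _; rewrite setX_bigcupl.
    rewrite measure_semi_bigcup//.
    - by move=> k; exact: mX.
    - apply/trivIsetP => k l _ _ kl; rewrite -setXI.
      by move/trivIsetP : tF => /(_ k l Logic.I Logic.I kl) ->; rewrite set0X.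
    - by rewrite -setX_bigcupl; exact: mX.
  by apply: is_cvg_nneseries => k _ _; exact: p_ge0.
have pT : p setT = 1.
  rewrite /p /marg setXTT (eq_integral (cst 1)); last first.
    by move=> y _; rewrite probability_setT.
  rewrite integral_cst// mul1e [X in _ * X]muDE -EFinM mulVf// gt_eqF//.
pose Hm := isMeasure.Build _ _ _ p p0 p_ge0 ps.
pose mp : {measure set (borel V) -> \bar R} := HB.pack p Hm.
pose Hp := Measure_isProbability.Build _ _ _ mp pT.
pose pp : probability (borel V) R := HB.pack p Hm Hp.
by exists pp.
Qed.

Variable K : set VV.
Hypothesis clK : closed K.
Hypothesis uK : forall l,
  {ae mu2, forall z, (D `*` D) z -> K (u l z.1 : V, u l z.2 : V)}.

(** A rectangle that misses [K] is not charged in the limit. *)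
Let s_eq0 i j : C i `*` C j `<=` ~` K -> s i j D D = 0.
Proof.
move=> CK.
have mu1 l : measurable_fun (D `*` D) (fun z => u l z.1).
  apply: (measurable_comp mD _ (mu_ l) (g := fst)); last exact: measurable_funTS.
  by move=> _ [z [Dz _] <-].
have mu2' l : measurable_fun (D `*` D) (fun z => u l z.2).
  apply: (measurable_comp mD _ (mu_ l) (g := snd)); last exact: measurable_funTS.
  by move=> _ [z [_ Dz] <-].
suff t0 k : t i j k D D = 0.
  have H1 : (fun k => t i j k D D) @ \oo --> s i j D D by exact: s_cvg.
  apply: (ecvgn_unique H1); apply: cvg_near_cst; apply: nearW => k.
  by rewrite t0.
have a0 l : a l i k D * a l j k D = 0.
  rewrite -integral_setX_mul//; last 4 first.
  - by apply/measurable_EFinP; apply: measurableT_comp.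
  - by apply/measurable_EFinP; apply: measurableT_comp.
  - by move=> x _; rewrite lee_fin.
  - by move=> x _; rewrite lee_fin.
  rewrite -(integral0 mu2 (D `*` D)); apply: ae_eq_integral => //.
  - exact: measurableX.
  - apply: emeasurable_funM; apply/measurable_EFinP.
      exact: (measurableT_comp (mf i k) (mu1 l)).
    exact: (measurableT_comp (mf j k) (mu2' l)).
  - apply: filterS (uK l) => z /[swap] Dz /(_ Dz) Kz /=.
    rewrite -EFinM; congr (_%:E).
    have [Cz|nCz] := pselect ((C i `*` C j) (u l z.1 : V, u l z.2 : V)).
      by have := CK _ Cz.
    have [nC|nC] : ~ C i (u l z.1) \/ ~ C j (u l z.2).
      by apply: contrapT => /not_orP[/contrapT ? /contrapT ?]; exact: nCz.
    - by rewrite f_out// mul0r.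
    - by rewrite [X in (_ * X)%R]f_out// mulr0.
have H1 : (fun l => a l i k D * a l j k D) @ \oo --> t i j k D D by exact: a_cvg.
apply: (ecvgn_unique H1); apply: cvg_near_cst; apply: nearW => l.
by rewrite a0.
Qed.

(** A limit of nonlocal fields with values in the closed set [K] is a product
    [nu x \x nu y], carried by a Cartesian subset of [K]. *)
Lemma limit_structure : exists (nu : T -> probability (borel V) R) (A : set V),
  [/\ forall B, measurable B -> measurable_fun setT (fun x => nu x B),
      A `*` A `<=` K &
      {ae mu2, forall z, (D `*` D) z ->
         charge_eq (Lam z) (nu z.1 \x nu z.2) /\
         charge_support (Lam z) `<=` A `*` A} ].
Proof.
have [nu nuE] := marginal.
have [_ bC _ [i1 Ci1] _] := Cf.
have mnu B : measurable B -> measurable_fun setT (fun x => nu x B).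
  move=> mB; rewrite (_ : (fun x => _) = fun x => (c^-1)%:E * marg B x).
    by apply: measurable_funeM; exact: mmarg.
  by apply/funext => x; rewrite nuE.
have mC i : measurable (C i : set (borel V)) by exact: (measurable_base Cf).
have mCC i j : measurable (C i `*` C j : set (borel VV)) by exact: measurableX_borel.
pose r i E := \int[mu]_(x in E) nu x (C i).
have rE i E : measurable E -> E `<=` D -> s i i1 E D = c%:E * r i E.
  move=> mE ED; rewrite /s ge0_integral_setX//; last exact: mlam.
  have c_ge0 : 0 <= c%:E by rewrite lee_fin ltW.
  have mnuE : measurable_fun E (fun x => nu x (C i)).
    by apply: measurable_funTS; exact: mnu.
  rewrite -(ge0_integralZl _ mE mnuE)//.
  apply: eq_integral => x _; rewrite nuE// muleA -EFinM mulfV ?gt_eqF// mul1e.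
  by rewrite Ci1.
have r_fin i E : measurable E -> E `<=` D -> r i E \is a fin_num.
  move=> mE ED; rewrite ge0_fin_numE ?integral_ge0//.
  apply: (@le_lt_trans _ _ (\int[mu]_(x in E) cst 1 x)).
    apply: ge0_le_integral => //; first by apply: measurable_funTS; exact: mnu.
    by move=> x _; exact: probability_le1.
  rewrite integral_cst// mul1e; apply: le_lt_trans Doo.
  by apply: le_measure; rewrite ?inE.
(* the exchange relation with the second rectangle D `*` D and i1 as the second
   pair of indices: s i j E F * c ^ 2 = (c * r i E) * (c * r j F) *)
have sE i j E F : measurable E -> measurable F -> E `<=` D -> F `<=` D ->
    s i j E F = r i E * r j F.
  move=> mE mF ED FD.
  have := @s_exchange i j i1 i1 E F D D mE mF ED FD mD mD (@subset_refl _ D) (@subset_refl _ D).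
  rewrite (rE i E)// (s_sym i1 j mD mF)// (rE j F)// (rE i1 D)//.
  have -> : r i1 D = c%:E.
    rewrite /r (eq_integral (cst 1)) ?integral_cst ?mul1e//.
    by move=> x _; rewrite Ci1 probability_setT.
  rewrite -(fineK (s_fin i j mE mF ED FD)) -(fineK (r_fin i E mE ED)).
  rewrite -(fineK (r_fin j F mF FD)) -!EFinM => -[] H; congr (_%:E).
  have cc : (c * c != 0)%R by rewrite mulf_neq0// gt_eqF.
  by apply: (mulIf cc); rewrite H; ring.
have prodE : {ae mu2, forall z, forall ij : I * I, (D `*` D) z ->
    lam z (C ij.1 `*` C ij.2) = nu z.1 (C ij.1) * nu z.2 (C ij.2)}.
  apply: ae_forall_countable => -[i j].
  apply: integral_rect_ae_eq => //=.
  - exact: mlam.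
  - apply: emeasurable_funM.
      exact: (measurableT_comp (mnu _ (mC i)) measurable_fst).
    exact: (measurableT_comp (mnu _ (mC j)) measurable_snd).
  - by move=> z; rewrite mule_ge0.
  - by rewrite -ge0_fin_numE ?integral_ge0//; exact: s_fin.
  - move=> E F mE mF ED FD; transitivity (r i E * r j F); first exact: sE.
    apply/esym; apply: (@integral_setX_mul _ _ _ mu E F
      (fun x => nu x (C i)) (fun x => nu x (C j))) => //.
      by apply: measurable_funTS; exact: mnu.
    by apply: measurable_funTS; exact: mnu.
have suppE : {ae mu2, forall z, forall i : I, (D `*` D) z -> r i D = 0 ->
    lam z (C i `*` setT) = 0 /\ lam z (setT `*` C i) = 0}.
  apply: ae_forall_countable => i.
  have [ri0|ri0] := eqVneq (r i D) 0; last first.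
    by apply: aeW => z Dz H; rewrite H eqxx in ri0.
  have H j j' : r j D = 0 \/ r j' D = 0 ->
      {ae mu2, forall z, (D `*` D) z -> lam z (C j `*` C j') = 0}.
    move=> rr; have sjj : s j j' D D = 0.
      by rewrite sE//; case: rr => ->; rewrite ?mul0e ?mule0.
    apply/(ae_eq_integral_abs _ (measurableX mD mD)).
      by apply: measurable_funTS; exact: mlam.
    by rewrite -[RHS]sjj; apply: eq_integral => z _; rewrite gee0_abs.
  have := H i i1 (or_introl ri0); have := H i1 i (or_intror ri0).
  by rewrite Ci1; apply: filterS2 => z h1 h2 Dz _; split; [exact: h2|exact: h1].
(* A is the support of the average of nu over D *)
exists nu, [set x | forall i, C i x -> r i D != 0]; split=> //.
- move=> [x y] /= [Ax Ay]; apply: contrapT => nK.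
  have oK : open (~` K) by exact: closed_openC.
  have [_ bCC _ _ _] := bump_base_pair Cf Cf.
  have [[i j] [[/= Cx Cy] CK]] := bCC _ _ oK nK.
  have := s_eq0 CK; rewrite sE// => /eqP; rewrite mule_eq0.
  by rewrite (negbTE (Ax i Cx)) (negbTE (Ay j Cy)).
- apply: filterS3 Lamlam prodE suppE => z LL PP SS Dz; split.
    move=> B mB; rewrite LL//.
    by apply: (prod_measure_unique_base Cf Cf) => // i j; exact: (PP (i, j)).
  have oC i : open (C i) by have [+ _ _ _ _] := Cf; exact.
  move=> w supw; split=> i Ci; apply/negP => /eqP ri0.
  + have oU : open (C i `*` setT : set VV).
      rewrite (_ : _ `*` _ = fst @^-1` C i); last by apply/seteqP; split=> [w0 [] //|w0 Cw]; split.
      by apply: open_comp => // ? _; exact: cvg_fst.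
    have [B [mB BU /eqP LB0]] := supw _ oU (conj Ci Logic.I).
    apply: LB0; apply/eqP; rewrite eq_le LL// measure_ge0 andbT.
    rewrite -(SS i Dz ri0).1; apply: le_measure; rewrite ?inE//; exact: mX.
  + have oU : open (setT `*` C i : set VV).
      rewrite (_ : _ `*` _ = snd @^-1` C i); last by apply/seteqP; split=> [w0 [] //|w0 Cw]; split.
      by apply: open_comp => // ? _; exact: cvg_snd.
    have [B [mB BU /eqP LB0]] := supw _ oU (conj Logic.I Ci).
    apply: LB0; apply/eqP; rewrite eq_le LL// measure_ge0 andbT.
    rewrite -(SS i Dz ri0).2; apply: le_measure; rewrite ?inE//.
    exact: (measurableX_borel measurableT).
Qed.

End limit_measure.

(** * Labels and averages over cells *)

Section labels.
Context {X : Type}.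

(** The [label] of a point records to which of the first [k] sets of a
    sequence it belongs. *)
Definition label (F : nat -> set X) k (x : X) : {ffun 'I_k -> bool} :=
  [ffun i : 'I_k => x \in F i].

Lemma label_mem (F : nat -> set X) k x y i : (i < k)%N ->
  label F k x = label F k y -> F i x -> F i y.
Proof.
move=> ik /ffunP/(_ (Ordinal ik)); rewrite !ffunE/= => xy Fx.
by apply: set_mem; rewrite -xy mem_set.
Qed.

(** The partition by the first [j] sets refines the one by the first [k] sets. *)
Lemma label_coarsen (F : nat -> set X) j k (l : {ffun 'I_k -> bool}) :
  (k <= j)%N -> exists P : pred {ffun 'I_j -> bool},
    forall x, (label F k x == l) = P (label F j x).
Proof.
move=> kj; exists (fun l' => [forall i : 'I_k, l' (widen_ord kj i) == l i]) => x.
apply/eqP/forallP => [<- i|H]; first by rewrite !ffunE.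
by apply/ffunP => i; rewrite ffunE -(eqP (H i)) ffunE.
Qed.

End labels.

Lemma measurable_label d (T : measurableType d) (F : nat -> set T) k l :
  (forall i, measurable (F i)) -> measurable [set x | label F k x = l].
Proof.
move=> mF.
rewrite (_ : [set x | _] = ~` \bigcup_(i in [set: 'I_k])
    (if l i then ~` F i else F i)).
  apply: measurableC; apply: countable_bigcupT_measurable.
    exact: countableP.
  by move=> i; case: ifP => _; [exact: measurableC|].
apply/seteqP; split=> [x /= <- [i _]|x /= H].
  rewrite ffunE; case: ifPn => [/set_mem Fx nF|nF Fx]; first exact: nF.
  by rewrite mem_set in nF.
apply/ffunP => i; rewrite ffunE; apply: contrapT => ne; apply: H.
exists i => //; move: ne; case: (l i); have [|/negP] := boolP (x \in F i) => //.
- by rewrite inE.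
- by rewrite inE.
Qed.

Section label_sums.
Context {R : realType}.

Lemma Rintegral_sum d (T : measurableType d) (mu : {measure set T -> \bar R})
    (D : set T) (I : Type) (s : seq I) (h : I -> T -> R) :
  measurable D -> (forall i, mu.-integrable D (EFin \o h i)) ->
  mu.-integrable D (EFin \o (fun x => \sum_(i <- s) h i x)) /\
  \int[mu]_(x in D) (\sum_(i <- s) h i x) =
  \sum_(i <- s) \int[mu]_(x in D) h i x.
Proof.
move=> mD ih; elim: s => [|i s [IH1 IH2]].
  split.
    rewrite (_ : _ \o _ = cst 0%E); first exact: integrable0.
    by apply/funext => x /=; rewrite big_nil.
  rewrite big_nil -[RHS](mul0r (fine (mu D))) -Rintegral_cst//.
  by apply: eq_Rintegral => x _; rewrite big_nil.
split.
  rewrite (_ : _ \o _ = ((EFin \o h i) \+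
    (EFin \o (fun x => \sum_(j <- s) h j x)%R))%E); first exact: integrableD.
  by apply/funext => x /=; rewrite big_cons.
rewrite big_cons -IH2 -RintegralD//.
by apply: eq_Rintegral => x _; rewrite big_cons.
Qed.

Lemma finite_labelE (X : Type) (L : finType) (g : X -> L) (F : L -> R) x :
  F (g x) = \sum_l F l * \1_[set y | g y = l] x.
Proof.
rewrite (bigD1 (g x))//= indicE mem_set//= mulr1 big1 ?addr0// => l lg.
by rewrite indicE memNset ?mulr0//= => gx; rewrite gx eqxx in lg.
Qed.

Lemma Rintegral_label d (Y : measurableType d) (p : probability Y R)
    (L : finType) (g : Y -> L) (F : L -> R) :
  (forall l, measurable [set y | g y = l]) ->
  p.-integrable setT (EFin \o (F \o g)) /\
  \int[p]_y F (g y) = \sum_l F l * fine (p [set y | g y = l]).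
Proof.
move=> mg.
have i1 l : p.-integrable setT (EFin \o \1_[set y | g y = l]) by exact: integrable_indic.
have iF l : p.-integrable setT (EFin \o (fun y => F l * \1_[set y | g y = l] y)).
  rewrite (_ : _ \o _ = (fun y => (F l)%:E * (EFin \o \1_[set y | g y = l]) y)%E).
    exact: integrableZl.
  by apply/funext => y /=; rewrite EFinM.
have [H1 H2] := Rintegral_sum (index_enum L) measurableT iF.
have E : F \o g = fun y => \sum_l F l * \1_[set y | g y = l] y.
  by apply/funext => y /=; exact: finite_labelE.
split; first by rewrite E.
rewrite (_ : (fun y => F (g y)) = F \o g)// E H2; apply: eq_bigr => l _.
by rewrite RintegralZl// /Rintegral integral_indic// setIT.
Qed.

End label_sums.

Section oscillation.
Context {R : realType} {V : normedModType R}.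

(** Uniform continuity on a compact set [A `*` A], in terms of the labels of a
    countable base. Only one of the two points compared has to lie in
    [A `*` A]. *)
Lemma compact_oscillation (C : nat -> set V) (A : set V) (phi : V * V -> R) (e : R) :
  (forall i, open (C i)) ->
  (forall U x, open U -> U x -> exists i, C i x /\ C i `<=` U) ->
  compact A -> continuous phi -> 0 < e ->
  exists k, forall x y x' y', A x -> A y ->
    label C k x = label C k x' -> label C k y = label C k y' ->
    `|phi (x, y) - phi (x', y')| <= e.
Proof.
move=> oC bC cA cphi e0.
have cAA : compact (A `*` A) by exact: compact_setX.
pose P k (z : V * V) := forall x' y', label C k z.1 = label C k x' ->
  label C k z.2 = label C k y' -> `|phi z - phi (x', y')| <= e.
have [|k _ kP] := (compact_near_coveringP _).1 cAA nat \oo P _; last first.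
  exists k => x y x' y' Ax Ay; exact: (kP k (leqnn k) (x, y) (conj Ax Ay)).
move=> [x y] [Ax Ay].
have e2 : 0 < e / 2 by rewrite divr_gt0.
have := cphi (x, y) => /cvgrPdist_le/(_ _ e2) [[U W] /= [Ux Wy] UW].
move: Ux Wy; rewrite !nbhsE => -[U' [oU' U'x] U'U] [W' [oW' W'y] W'W].
have [i [Cix CiU]] := bC _ _ oU' U'x; have [j [Cjy CjW]] := bC _ _ oW' W'y.
exists (C i `*` C j, [set k | (maxn i j < k)%N]) => /=.
  split; first by exists (C i, C j) => //=; split; apply: open_nbhs_nbhs; split.
  by exists (maxn i j).+1.
move=> [[x1 y1] k] /= [[Cx1 Cy1] /= ]; rewrite gtn_max => /andP[ik jk].
move=> x' y' /(label_mem ik)/(_ Cx1) Cx' /(label_mem jk)/(_ Cy1) Cy'.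
rewrite (splitr e) -[X in `|X|](subrKA (phi (x, y))).
apply: (le_trans (ler_normD _ _)); rewrite lerD//.
  rewrite distrC; apply: (UW (x1, y1)) => /=; split.
    exact/U'U/CiU.
  exact/W'W/CjW.
apply: (UW (x', y')) => /=; split; first exact/U'U/CiU.
exact/W'W/CjW.
Qed.

End oscillation.

Section kernel_averages.
Context {R : realType}.

Lemma normr_Rintegral_le d (T : measurableType d) (mu : {measure set T -> \bar R})
    (D : set T) (h : T -> R) (e : R) : measurable D -> (mu D < +oo)%E -> 0 <= e ->
  mu.-integrable D (EFin \o h) -> {ae mu, forall x, D x -> `|h x| <= e} ->
  `|\int[mu]_(x in D) h x| <= e * fine (mu D).
Proof.
move=> mD Doo e0 ih he; apply: (le_trans (le_normr_Rintegral mD ih)).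
have mh := measurable_int mu ih.
have D_fin : mu D \is a fin_num by rewrite ge0_fin_numE.
have inh := integrable_norm ih.
have hE : (\int[mu]_(x in D) `|h x|)%:E = (\int[mu]_(x in D) (`|h x|)%:E)%E.
  by rewrite /Rintegral fineK//; exact: integrable_fin_num.
rewrite -lee_fin EFinM (fineK D_fin) hE.
rewrite -integral_cst//; apply: ae_ge0_le_integral => //.
exact: (measurable_int mu inh).
Qed.

Lemma normr_Rintegral_prob_le d (Y : measurableType d) (p : probability Y R)
    (h : Y -> R) (e : R) : 0 <= e -> p.-integrable setT (EFin \o h) ->
  {ae p, forall y, `|h y| <= e} -> `|\int[p]_y h y| <= e.
Proof.
move=> e0 ih he.
have pT : fine (p setT) = 1 by rewrite [X in fine X](probability_setT p).
rewrite -[leRHS]mulr1 -pT; apply: normr_Rintegral_le => //.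
  exact: le_lt_trans (probability_le1 p measurableT) (ltry 1).
by apply: filterS he => y + _.
Qed.

Context d (T : measurableType d) (mu : {measure set T -> \bar R}).
Context d' (Y : measurableType d').
Variable k : T -> probability Y R.
Hypothesis mk : forall B, measurable B -> measurable_fun setT (fun x => k x B).

Let bint (p : probability Y R) (h : Y -> R) (M : R) : measurable_fun setT h ->
  (forall y, `|h y| <= M) -> p.-integrable setT (EFin \o h).
Proof.
move=> mh hM; apply: (bounded_integrable measurableT _ mh (N := M)) => //.
exact: le_lt_trans (probability_le1 p measurableT) (ltry 1).
Qed.

Variables (phi : Y -> R) (M : R).
Hypotheses (mphi : measurable_fun setT phi) (phiM : forall y, `|phi y| <= M).

Lemma Rintegral_prob_le x : `|\int[k x]_y phi y| <= M.
Proof.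
have M0 : 0 <= M := le_trans (normr_ge0 _) (phiM point).
apply: normr_Rintegral_prob_le => //; first exact: (bint _ mphi phiM).
exact: aeW.
Qed.

Lemma measurable_Rintegral_kernel : measurable_fun setT (fun x => \int[k x]_y phi y).
Proof.
have E x : (\int[k x]_y (phi y + M)%:E = (\int[k x]_y phi y + M)%:E)%E.
  under eq_integral do rewrite EFinD.
  have iM : (k x).-integrable setT (cst M%:E).
    by apply: (bint _ (h := cst M) (M := `|M|)).
  rewrite integralD//; last exact: (bint _ mphi phiM).
  rewrite integral_cst// [X in (_ * X)%E]probability_setT mule1 EFinD; congr (_ + _)%E.
  by rewrite /Rintegral fineK//; apply: integrable_fin_num => //; exact: (bint _ mphi phiM).
rewrite (_ : (fun x => _) = fun x => fine (\int[k x]_y (phi y + M)%:E)%E - M).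
  apply: measurable_funB => //; apply: measurableT_comp => //.
  apply: (@measurable_fun_integral_kernel _ _ _ _ _ (fun z => k z)) => //.
    by move=> y; rewrite lee_fin; have := phiM y; rewrite ler_norml => /andP[? _]; lra.
  by apply/measurable_EFinP; exact: measurable_funD.
by apply/funext => x; rewrite E/= addrK.
Qed.

(** When, on a set [B] that carries the kernel [k], [phi] differs by at most [e]
    from a function of a finite-valued map [g], the averages of [phi] are
    determined up to [e] by the masses that [k] gives to the fibers of [g]. *)
Lemma kernel_average_label (L : finType) (g : Y -> L) (F : L -> R) (B : set Y)
    (Q : set T) (e : R) :
  (forall l, measurable [set y | g y = l]) -> measurable Q -> (mu Q < +oo)%E ->
  measurable B -> 0 <= e ->
  {ae mu, forall x, Q x -> k x B = 1%E} ->
  (forall y, B y -> `|phi y - F (g y)| <= e) ->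
  `|\int[mu]_(x in Q) \int[k x]_y phi y -
    \sum_l F l * fine (\int[mu]_(x in Q) k x [set y | g y = l])%E| <=
  e * fine (mu Q).
Proof.
move=> mg mQ Qoo mB e0 kB phiF.
pose Psi x := \sum_l F l * fine (k x [set y | g y = l]).
have k01 x l : 0 <= fine (k x [set y | g y = l]) <= 1.
  rewrite fine_ge0//= -lee_fin fineK ?probability_le1//.
  exact: fin_num_measure.
have mkl l : measurable_fun setT (fun x => fine (k x [set y | g y = l])).
  by apply: measurableT_comp => //; exact: mk.
have ikl l : mu.-integrable Q (EFin \o (fun x => fine (k x [set y | g y = l]))).
  apply: (bounded_integrable mQ Qoo (N := 1)); first exact: measurable_funTS.
  by move=> x _; have /andP[? ?] := k01 x l; rewrite ger0_norm.
have iFkl l : mu.-integrable Q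
    (EFin \o (fun x => F l * fine (k x [set y | g y = l]))).
  rewrite (_ : _ \o _ = (fun x => (F l)%:E *
    (EFin \o (fun x => fine (k x [set y | g y = l]))) x)%E).
    exact: integrableZl.
  by apply/funext => x /=; rewrite EFinM.
have [iPsi PsiE] := Rintegral_sum (index_enum L) mQ iFkl.
have -> : \sum_l F l * fine (\int[mu]_(x in Q) k x [set y | g y = l])%E =
    \int[mu]_(x in Q) Psi x.
  rewrite PsiE; apply: eq_bigr => l _; rewrite RintegralZl//; congr (_ * fine _).
  by apply: eq_integral => x _; rewrite fineK//; exact: fin_num_measure.
have iPhi : mu.-integrable Q (EFin \o (fun x => \int[k x]_y phi y)).
  apply: (bounded_integrable mQ Qoo (N := M)).
    apply: measurable_funTS; exact: measurable_Rintegral_kernel.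
  by move=> x _; exact: Rintegral_prob_le.
rewrite -RintegralB//; apply: normr_Rintegral_le => //.
  rewrite (_ : _ \o _ = ((EFin \o (fun x => \int[k x]_y phi y)%R) \- (EFin \o Psi))%E).
    exact: integrableB.
  by apply/funext => x /=; rewrite EFinB.
apply: filterS kB => x kB Qx; have {kB}kB := kB Qx.
have [iF FE] := Rintegral_label (k x) F mg; rewrite /Psi -FE.
have ip : (k x).-integrable setT (EFin \o phi) by exact: (bint _ mphi phiM).
rewrite -RintegralB//.
apply: normr_Rintegral_prob_le => //.
  rewrite (_ : _ \o _ = ((EFin \o phi) \- (EFin \o (F \o g)))%E); first exact: integrableB.
  by apply/funext => y /=; rewrite EFinB.
exists (~` B); split; first exact: measurableC.
  by rewrite probability_setC// kB subee.
by move=> y /= H By; apply: H; exact: phiF.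
Qed.

End kernel_averages.

(** * Generating a product Young measure *)

Lemma measurable_prod_gen d (T : measurableType d) (G : set (set T)) :
  @measurable _ T = <<s G >> -> G setT ->
  @measurable _ (T * T)%type = <<s [set A `*` B | A in G & B in G] >>.
Proof.
move=> GE GT; set GG := [set A `*` B | A in G & B in G].
have mG A : G A -> measurable A by move=> GA; rewrite GE; exact: sub_sigma_algebra.
apply/seteqP; split; last first.
  apply: smallest_sub; first exact: sigma_algebra_measurable.
  by move=> _ [A GA [B GB <-]]; apply: measurableX; exact: mG.
rewrite measurable_prod_measurableType; apply: smallest_sub.
  exact: smallest_sigma_algebra.
move=> _ [A mA [B mB <-]].
have m1 : measurable_fun setT (fst : g_sigma_algebraType GG -> T).
  apply: (@measurability _ _ _ _ _ _ G GE) => _ [S GS <-].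
  rewrite setTI; apply: sub_sigma_algebra; exists S => //; exists setT => //.
  by apply/seteqP; split=> [z [] //|z Sz]; split.
have m2 : measurable_fun setT (snd : g_sigma_algebraType GG -> T).
  apply: (@measurability _ _ _ _ _ _ G GE) => _ [S GS <-].
  rewrite setTI; apply: sub_sigma_algebra; exists setT => //; exists S => //.
  by apply/seteqP; split=> [z [] //|z Sz]; split.
have := @measurableI _ (g_sigma_algebraType GG) _ _ (m1 measurableT _ mA) (m2 measurableT _ mB).
by rewrite !setTI.
Qed.

Section generating_sequence.
Context {R : realType} d (T : measurableType d).
Variable mu : {sigma_finite_measure set T -> \bar R}.
Variables (D : set T) (J : countType) (E : J -> set T).
Hypotheses (mD : measurable D) (Doo : (mu D < +oo)%E) (divD : divisible mu D).
Hypotheses (mE : @measurable _ T = <<s range E >>) (EI : setI_closed (range E))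
  (ET : range E setT).
Context {V : normedModType R} {I : countType}.
Variables (C : I -> set V) (f : I -> nat -> V -> R).
Hypothesis Cf : bump_base C f.
Variables (A : set V) (a0 : V).
Hypotheses (cA : compact A) (Aa0 : A a0).
Local Notation mu2 := (product_measure1 mu mu).
Local Notation VV := (V * V)%type.
Variables (q : T -> probability (borel V) R) (lam : T * T -> probability (borel VV) R).
Hypothesis mq : forall B, measurable B -> measurable_fun setT (fun x => q x B).
Hypothesis mlam : forall B, measurable B -> measurable_fun setT (fun z => lam z B).
Hypothesis qA : {ae mu, forall x, D x -> q x A = 1%E}.
Hypothesis lamq : {ae mu2, forall z, (D `*` D) z ->
  forall B B' : set (borel V), measurable B -> measurable B' ->
    lam z (B `*` B' : set VV) = (q z.1 B * q z.2 B')%E}.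

Let mA : measurable (A : set (borel V)).
Proof.
have clA : closed A by apply: compact_closed cA; exact: norm_hausdorff.
rewrite -[A]setCK; apply: measurableC; apply: sub_sigma_algebra.
exact: closed_openC.
Qed.

(** Enumerations of the two bases by [nat], completed by the whole space. *)
Let E' i : set T := if unpickle i is Some j then E j else setT.
Let C' i : set V := if unpickle i is Some j then C j else setT.

Let mE' i : measurable (E' i).
Proof.
rewrite /E'; case: (unpickle i) => [j|]; last exact: measurableT.
by rewrite mE; apply: sub_sigma_algebra; exists j.
Qed.

Let mC' i : measurable (C' i : set (borel V)).
Proof.
by rewrite /C'; case: (unpickle i) => [j|]; [exact: (measurable_base Cf)|].
Qed.

Let mc k l : measurable ([set y | label C' k y = l] : set (borel V)).
Proof. exact: (@measurable_label _ (borel V)). Qed.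

(** On the first [j] sets [E' i], the map has the exact statistics of [q] for the
    partitions generated by at most [j] of the sets [C' i]. *)
Let generating_map j : exists u : T -> borel V,
  [/\ measurable_fun setT u, forall x, A (u x) &
    forall i k (l : {ffun 'I_k -> bool}), (i < j)%N -> (k <= j)%N ->
      mu (D `&` E' i `&` u @^-1` [set y | label C' k y = l]) =
      (\int[mu]_(x in D `&` E' i) q x [set y | label C' k y = l])%E].
Proof.
have me l : measurable [set x | label E' j x = l] by exact: measurable_label.
have [u0 [u0A mu0 u0E]] := sampling mD Doo divD mA Aa0 me (mc (k := j)) mq qA.
exists (fun x => if x \in D then u0 x else a0); split.
- move=> _ B mB; rewrite setTI.
  rewrite (_ : _ @^-1` B = (D `&` u0 @^-1` B) `|` (~` D `&` (if a0 \in B then setT else set0))).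
    apply: measurableU; first exact: mu0.
    by apply: measurableI; [exact: measurableC|case: ifP].
  apply/seteqP; split=> x /=.
    case: ifPn => [/set_mem Dx Bx|Dx Ba]; first by left.
    by right; split; [move/negP: Dx; rewrite inE|rewrite mem_set].
  case=> [[Dx Bx]|[nDx]]; first by rewrite mem_set.
  by rewrite memNset//; case: ifP => [/set_mem|].
- by move=> x; case: ifP.
- move=> i k l ij kj; have [P2 P2E] := label_coarsen C' l kj.
  pose P1 (l : {ffun 'I_j -> bool}) := l (Ordinal ij).
  have P1E : [set x | P1 (label E' j x)] = E' i.
    by apply/seteqP; split=> x; rewrite /P1/= ffunE inE.
  have cE : [set y | label C' k y = l] = [set y | P2 (label C' j y)].
    by apply/seteqP; split=> y /=; rewrite -P2E => /eqP.
  have := u0E P1 P2; rewrite P1E -cE => <-; congr (mu _).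
  apply/seteqP; split=> x /=.
    move=> [[Dx Ex]]; rewrite mem_set// => cu; split=> //; split.
      by have := Ex; rewrite -P1E.
    by rewrite -P2E cu.
  move=> [Dx [Ex cu]]; split; first by split=> //; rewrite -P1E.
  by rewrite mem_set//; apply/eqP; rewrite P2E.
Qed.

Let lamA : {ae mu2, forall z, (D `*` D) z -> lam z (A `*` A : set VV) = 1%E}.
Proof.
apply: filterS2 lamq (ae_setX qA qA) => z H1 H2 Dz.
by rewrite (H1 Dz)//; have [-> ->] := H2 Dz; rewrite mule1.
Qed.

(** For every bounded continuous [phi], the functions [phi (u j x, u j y)] converge
    weakly-star to the integrals of [phi] against [lam]. The sequence does not
    depend on [phi]. *)
Lemma generating_sequence : exists u : nat -> T -> borel V,
  [/\ forall j, measurable_fun setT (u j), forall j x, A (u j x) &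
    forall (phi : VV -> R) (M : R), continuous phi -> (forall w, `|phi w| <= M) ->
    forall h : T * T -> R, mu2.-integrable (D `*` D) (EFin \o h) ->
      \int[mu2]_(z in D `*` D)
        (h z * (phi (u j z.1 : V, u j z.2 : V) - \int[lam z]_w phi w))
        @[j --> \oo] --> (0 : R)].
Proof.
have [u uP] := choice generating_map.
have mu_ j : measurable_fun setT (u j) by have [] := uP j.
have uA j x : A (u j x) by have [] := uP j.
exists u; split=> // phi M cphi phiM.
have mDD : measurable (D `*` D) by exact: measurableX.
have DDoo := setX_lty mD Doo.
have mphi : measurable_fun setT (phi : borel VV -> R).
  exact: measurable_continuous_borel.
pose v j (z : T * T) : borel VV := (u j z.1 : V, u j z.2 : V).
have mv j : measurable_fun setT (v j).
  have H : measurable_fun setT (fun z : T * T => (u j z.1, u j z.2)).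
    apply/measurable_fun_pairP; split.
      exact: (measurableT_comp (mu_ j) measurable_fst).
    exact: (measurableT_comp (mu_ j) measurable_snd).
  exact: (measurableT_comp (measurable_pair_borel Cf Cf) H).
have mPhi : measurable_fun setT (fun z => \int[lam z]_w phi w).
  exact: (measurable_Rintegral_kernel mlam mphi phiM).
have Phi_le z : `|\int[lam z]_w phi w| <= M := Rintegral_prob_le lam mphi phiM z.
have gM j z : (D `*` D) z -> `|phi (v j z) - \int[lam z]_w phi w| <= M + M.
  by move=> _; apply: (le_trans (ler_normB _ _)); rewrite lerD.
have mg j : measurable_fun (D `*` D) (fun z => phi (v j z) - \int[lam z]_w phi w).
  apply: measurable_funTS; apply: measurable_funB => //.
  exact: (measurableT_comp mphi (mv j)).
have rect i i' : \int[mu2]_(z in D `*` D)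
    (\1_(E' i `*` E' i') z * (phi (v j z) - \int[lam z]_w phi w))
    @[j --> \oo] --> (0 : R).
  apply/cvgr0Pnorm_le => e e0.
  pose m0 := fine (mu2 (D `*` D)).
  have m00 : 0 <= m0 by apply: fine_ge0.
  (* the two errors below are at most e' * m0 each *)
  pose e' := e / 2 / (m0 + 1).
  have e'0 : 0 < e' by rewrite !divr_gt0// ltr_wpDl.
  have [k kP] : exists k, forall x y x' y', A x -> A y ->
      label C' k x = label C' k x' -> label C' k y = label C' k y' ->
      `|phi (x, y) - phi (x', y')| <= e'.
    have [oC bC _ _ _] := Cf; apply: compact_oscillation => //.
      by move=> l; rewrite /C'; case: (unpickle l) => [l'|]; [exact: oC|exact: openT].
    move=> U x oU Ux; have [l [Cx CU]] := bC _ _ oU Ux.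
    by exists (pickle l); rewrite /C' pickleK.
  (* a point of A in each cell that meets A *)
  have /choice[rep repP] (l : {ffun 'I_k -> bool}) : exists y, A y /\
      forall x, A x -> label C' k x = l -> label C' k y = l.
    have [[y [Ay yl]]|H] := pselect (exists y, A y /\ label C' k y = l).
      by exists y.
    by exists a0; split=> // x Ax xl; exfalso; apply: H; exists x.
  exists (maxn (maxn i i') k).+1 => // j /=; rewrite !gtn_max -andbA.
  move=> /and3P[ij i'j /ltnW kj].
  pose P := D `&` E' i; pose P' := D `&` E' i'.
  have mP : measurable P by exact: measurableI.
  have mP' : measurable P' by exact: measurableI.
  pose Q := P `*` P'.
  have mQ : measurable Q by exact: measurableX.
  have QD : Q `<=` D `*` D by move=> z [[Dz _] [Dz' _]].
  have Qm0 : fine (mu2 Q) <= m0.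
    rewrite /m0 fine_le ?ge0_fin_numE//.
      by apply: le_lt_trans DDoo; apply: le_measure; rewrite ?inE.
    by apply: le_measure; rewrite ?inE.
  have Qoo : (mu2 Q < +oo)%E.
    by apply: le_lt_trans DDoo; apply: le_measure; rewrite ?inE.
  have -> : \int[mu2]_(z in D `*` D)
      (\1_(E' i `*` E' i') z * (phi (v j z) - \int[lam z]_w phi w)) =
      \int[mu2]_(z in Q) phi (v j z) - \int[mu2]_(z in Q) \int[lam z]_w phi w.
    have i1 : mu2.-integrable Q (EFin \o (fun z => phi (v j z))).
      apply: (bounded_integrable mQ Qoo (N := M)) => //.
      by apply: measurable_funTS; exact: (measurableT_comp mphi (mv j)).
    have i2 : mu2.-integrable Q (EFin \o (fun z => \int[lam z]_w phi w)).
      apply: (bounded_integrable mQ Qoo (N := M)) => //.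
      exact: measurable_funTS.
    rewrite -RintegralB// /Q /P /P' setXI [RHS]Rintegral_mkcondr.
    apply: eq_Rintegral => z _; rewrite patchE indicE.
    by case: ifP; rewrite ?mul1r ?mul0r.
  (* phi (v j z) is an average against a kernel as well, a Dirac measure *)
  pose kap z : probability (borel VV) R := @dirac _ (borel VV) (v j z) R.
  have mkap B : measurable B -> measurable_fun setT (fun z => kap z B).
    move=> mB; rewrite (_ : (fun z => _) = EFin \o (\1_B \o v j))//.
    by apply/measurable_EFinP; exact: measurableT_comp (mv j).
  have kapE z : \int[kap z]_w phi w = phi (v j z).
    rewrite /Rintegral integral_dirac//; last exact/measurable_EFinP.
    by rewrite diracT mul1e.
  pose L := {ffun 'I_k -> bool}.
  pose g (w : borel VV) : L * L := (label C' k w.1, label C' k w.2).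
  pose F (l : L * L) := phi (rep l.1, rep l.2).
  have gE (l : L * L) : [set w | g w = l] =
      [set x | label C' k x = l.1] `*` [set x | label C' k x = l.2].
    by case: l => l l'; apply/seteqP; split=> -[x y]; rewrite /g/= => -[-> ->].
  have mgl l : measurable ([set w | g w = l] : set (borel VV)).
    by rewrite gE; apply: measurableX_borel; exact: mc.
  have mAA : measurable (A `*` A : set (borel VV)) by exact: measurableX_borel.
  have phiF w : (A `*` A) w -> `|phi w - F (g w)| <= e'.
    case: w => x y [/= Ax Ay]; apply: kP => //; apply/esym.
      exact: (repP _).2 Ax erefl.
    exact: (repP _).2 Ay erefl.
  have K1 := kernel_average_label mkap mphi phiM mgl mQ Qoo mAA (ltW e'0) _ phiF.
  have K2 := kernel_average_label mlam mphi phiM mgl mQ Qoo mAA (ltW e'0) _ phiF.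
  have {}K1 := K1 _; have {}K2 := K2 _.
  (* both kernels give the same masses to the cells, by the choice of u j *)
  have cellE l : (\int[mu2]_(z in Q) kap z [set w | g w = l] =
      \int[mu2]_(z in Q) lam z [set w | g w = l])%E.
    pose cell (l : L) : set (borel V) := [set x | label C' k x = l].
    have mcell l' : measurable (cell l') by exact: mc.
    have indE (S : set (borel V)) (B : set T) : measurable S -> measurable B ->
        (\int[mu]_(x in B) (\1_S (u j x))%:E = mu (B `&` u j @^-1` S))%E.
      move=> mS mB; have mj : measurable (u j @^-1` S).
        by rewrite -[X in measurable X]setTI; exact: mu_.
      by rewrite setIC -integral_indic//; apply: eq_integral.
    transitivity (mu (P `&` u j @^-1` cell l.1) * mu (P' `&` u j @^-1` cell l.2))%E.
      rewrite -!indE// -integral_setX_mul//; last 2 first.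
      - apply/measurable_EFinP/measurable_funTS; exact: measurableT_comp (mu_ j).
      - apply/measurable_EFinP/measurable_funTS; exact: measurableT_comp (mu_ j).
      apply: eq_integral => z _; rewrite gE -EFinM.
      rewrite [LHS]diracE indicE indicE -natrM mulnb; congr (_%:R%:E).
      by rewrite in_setX.
    have [_ _ uPj] := uP j.
    rewrite uPj// uPj// -integral_setX_mul//; last 2 first.
    - exact/measurable_funTS/mq.
    - exact/measurable_funTS/mq.
    apply: ae_eq_integral => //.
    - apply: measurable_funTS; apply: emeasurable_funM.
        exact: (measurableT_comp (mq (mcell _)) measurable_fst).
      exact: (measurableT_comp (mq (mcell _)) measurable_snd).
    - by apply: measurable_funTS; apply: mlam.
    - by apply: filterS lamq => z Hz Qz; rewrite gE (Hz (QD _ Qz)).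
  move: K1 K2; under eq_bigr do rewrite cellE.
  rewrite (eq_Rintegral _ (g := fun z => phi (v j z))) => [K1 K2|z _]; last exact: kapE.
  rewrite -(subrKA (\sum_(l : L * L)
    F l * fine (\int[mu2]_(z in Q) lam z [set w | g w = l])%E)).
  apply: (le_trans (ler_normD _ _)).
  rewrite [X in _ + X]distrC.
  apply: (@le_trans _ _ (e' * m0 + e' * m0)).
    rewrite lerD//.
      apply: le_trans (K1 _) _; last by rewrite ler_wpM2l// ltW.
      by apply: aeW => z _; rewrite [LHS]diracE mem_set//; split; exact: uA.
    apply: le_trans (K2 _) _; last by rewrite ler_wpM2l// ltW.
    by apply: filterS lamA => z Hz Qz; exact: Hz (QD _ Qz).
  rewrite -mulrDl [leRHS](_ : e = (e' + e') * (m0 + 1)).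
    by rewrite ler_wpM2l// ?lerDl// addr_ge0// ltW.
  by rewrite /e'; field; rewrite gt_eqF// ltr_wpDl.
have E'E B : range E B -> exists i, E' i = B.
  by move=> [j _ <-]; exists (pickle j); rewrite /E' pickleK.
apply: (@weak_star _ _ _ mu2 (D `*` D)
   (fun j z => phi (v j z) - \int[lam z]_w phi w) (M + M) mDD DDoo mg gM
   [set B `*` B' | B in range E & B' in range E]).
- exact: measurable_prod_gen.
- move=> _ _ [B GB [B' GB' <-]] [B1 GB1 [B1' GB1' <-]].
  exists (B `&` B1); first exact: EI.
  by exists (B' `&` B1'); [exact: EI|rewrite setXI].
- have [i iE] := E'E _ ET.
  apply: cvg_trans (rect i i); apply: near_eq_cvg; apply: nearW => j.
  by apply: eq_Rintegral => z _; rewrite iE setXTT indicT mul1r.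
- by move=> _ [B /E'E[i <-] [B' /E'E[i' <-] <-]]; exact: rect.
Qed.

End generating_sequence.

(** * Functions vanishing at infinity and supports of charges *)

Section continuous_vanishing.
Context {R : realType} {V : normedModType R}.

Lemma C0_continuous (phi : V -> R) : C0 phi -> continuous phi.
Proof.
move=> C0phi x; apply/cvgrPdist_le => e e0.
have e3 : 0 < e / 3 by rewrite divr_gt0.
have [g [sg _ gphi]] := C0phi _ e3.
have := smooth_continuous sg => /(_ x) /cvgrPdist_le/(_ _ e3).
apply: filterS => y gxy.
have := gphi x; have := gphi y; move: gxy.
by rewrite !ler_norml => /andP[? ?] /andP[? ?] /andP[? ?]; apply/andP; split; lra.
Qed.

Lemma C0_bounded (phi : V -> R) : C0 phi -> exists M, forall x, `|phi x| <= M.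
Proof.
move=> C0phi; have [g [sg cg gphi]] := C0phi 1 ltr01.
have cgc : {within closure [set x | g x != 0], continuous g}.
  by apply: continuous_subspaceT; exact: smooth_continuous.
have := compact_bounded (continuous_compact cgc cg).
move=> [M [_ gM]].
have gM1 x : `|g x| <= `|M| + 1.
  have [->|gx] := eqVneq (g x) 0; first by rewrite normr0 addr_ge0.
  apply: gM; first by rewrite (le_lt_trans (ler_norm _))// ltrDl.
  by exists x => //; exact: subset_closure.
exists (`|M| + 1 + 1) => x; rewrite -[phi x](subrK (g x)) addrC.
by apply: (le_trans (ler_normD _ _)); rewrite lerD.
Qed.

End continuous_vanishing.

Section charge_supports.
Context {R : realType} {V : normedModType R} {I : countType}.
Variables (C : I -> set V) (f : I -> nat -> V -> R).
Hypothesis Cf : bump_base C f.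
Local Open Scope ereal_scope.

(** The complement of [S] is covered by countably many null sets of the base. *)
Lemma charge_support_compl0 (nu : {charge set (borel V) -> \bar R})
    (p : {measure set (borel V) -> \bar R}) (S : set V) :
  charge_eq nu p -> closed S -> charge_support nu `<=` S -> p (~` S) = 0.
Proof.
move=> nup clS suppS; have [oC bC _ _ _] := Cf.
have mC i : measurable (C i : set (borel V)) by exact: (measurable_base Cf).
have mS : measurable (~` S : set (borel V)).
  by apply: sub_sigma_algebra; exact: closed_openC.
pose F k : set (borel V) := if unpickle k is Some i then
  if p (C i) == 0 then C i else set0 else set0.
have F0 k : p.-negligible (F k).
  rewrite /F; case: (unpickle k) => [i|]; last exact: negligible_set0.
  case: eqP => [pC0|_]; last exact: negligible_set0.
  by exists (C i); split.
apply/negligibleP => //; apply: negligibleS (negligible_bigcup F0) => w Sw.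
have : ~ charge_support nu w by move=> /suppS.
move=> /existsNP[U] /not_implyP[oU] /not_implyP[Uw nU].
have [i [Cw CU]] := bC _ _ oU Uw.
have pC0 : p (C i) = 0.
  rewrite -nup//; apply: contrapT => nC; apply: nU; exists (C i); split => //.
  exact/eqP.
by exists (pickle i) => //; rewrite /F pickleK pC0 eqxx.
Qed.

End charge_supports.

(** * Maximal Cartesian sets *)

Section cartesian.
Context {R : realType} {m : nat}.
Implicit Types (K E : set ('rV[R]_m * 'rV[R]_m)) (A : set 'rV[R]_m).

Lemma setX_hat K A : A `*` A `<=` K -> A `*` A `<=` hat K.
Proof. by move=> AK [x y] [/= Ax Ay]; split; apply: AK. Qed.

(** Zorn's lemma: an increasing union of sets [B] with [B `*` B `<=` E] has the same
    property. *)
Lemma max_cartesian_extension E A : A `*` A `<=` E ->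
  exists2 B, A `<=` B & max_cartesian E (B `*` B).
Proof.
(* adjoining A to B makes the empty chain harmless *)
move=> AE; pose P := [set B | (A `|` B) `*` (A `|` B) `<=` E].
have [|B [PB maxB]] := @Zorn_bigcup 'rV[R]_m P.
  move=> F FP totF; rewrite /P/=.
  have H X Y : F X -> F Y -> (A `|` X) `*` (A `|` Y) `<=` E.
    move=> FX FY [x y] /= [xX yY]; have [XY|YX] := totF _ _ FX FY.
      apply: (FP _ FY); split=> //=; case: xX => [|/XY]; [by left|by right].
    apply: (FP _ FX); split=> //=; case: yY => [|/YX]; [by left|by right].
  move=> [x y] /= [[Ax|[X FX Xx]] [Ay|[Y FY Yy]]].
  - exact: AE.
  - by apply: (H Y Y) => //; split; [left|right].
  - by apply: (H X X) => //; split; [right|left].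
  - by apply: (H X Y) => //; split; right.
exists (A `|` B); first exact: subsetUl.
exists (A `|` B); split=> // B' ABB' B'E.
apply: contrapT => nE; apply: (maxB B').
  split; first by move=> x Bx; apply: ABB'; right.
  by move=> B'B; apply: nE; apply/seteqP; split=> // x /B'B; right.
rewrite /P/=; have -> : A `|` B' = B' by apply/setUidPr => x Ax; apply: ABB'; left.
exact: B'E.
Qed.

Lemma closed_hat K : closed K -> closed (hat K).
Proof.
move=> clK.
pose f1 (p : 'rV[R]_m * 'rV[R]_m) := (p.1, p.1).
pose f2 (p : 'rV[R]_m * 'rV[R]_m) := (p.2, p.1).
pose f3 (p : 'rV[R]_m * 'rV[R]_m) := (p.2, p.2).
rewrite (_ : hat K = K `&` f1 @^-1` K `&` f2 @^-1` K `&` f3 @^-1` K); last first.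
  by apply/seteqP; split=> [p []|p [[[]]]].
have c1 : continuous f1 by move=> p; exact: (cvg_pair cvg_fst cvg_fst).
have c2 : continuous f2 by move=> p; exact: (cvg_pair cvg_snd cvg_fst).
have c3 : continuous f3 by move=> p; exact: (cvg_pair cvg_snd cvg_snd).
apply: closedI; [apply: closedI; [apply: closedI => //|]|].
- by apply: closed_comp => // p _; exact: c1.
- by apply: closed_comp => // p _; exact: c2.
- by apply: closed_comp => // p _; exact: c3.
Qed.

(** The closure of [A] satisfies the same inclusion, as [hat K] is closed. *)
Lemma max_cartesian_compact K A : compact K ->
  max_cartesian (hat K) (A `*` A) -> compact A.
Proof.
move=> cK [B [AB AK maxB]].
have {B AB maxB} maxA : forall B : set 'rV[R]_m, A `<=` B -> B `*` B `<=` hat K -> B = A.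
  suff -> : A = B by [].
  apply/seteqP; split=> x Ax.
    have [] : (B `*` B) (x, x) by rewrite -AB.
    by [].
  have [] : (A `*` A) (x, x) by rewrite AB.
  by [].
have clK : closed K by apply: compact_closed cK; exact: norm_hausdorff.
have clA : closed A.
  rewrite -(maxA (closure A)) //; first exact: closed_closure.
    exact: subset_closure.
  move=> [x y] [/= clx cly]; apply: contrapT => nK.
  have oK : open (~` hat K) by apply: closed_openC; exact: closed_hat.
  have [[U W] /= [Ux Wy] UW] := open_nbhs_nbhs (conj oK nK).
  have [x' [Ax' Ux']] := clx _ Ux; have [y' [Ay' Wy']] := cly _ Wy.
  by apply: (UW (x', y')) => //; exact: AK.
have cK1 : compact (fst @` K).
  apply: continuous_compact => //; apply: continuous_subspaceT => z.
  exact: cvg_fst.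
apply: subclosed_compact clA cK1 _ => x Ax.
by have [Kxx _ _ _] := AK (x, x) (conj Ax Ax); exists (x, x).
Qed.

End cartesian.

(** * The two inclusions *)

Section tensor_values.
Context {R : realType} d (T : measurableType d).
Variable mu : {sigma_finite_measure set T -> \bar R}.
Context {V : normedModType R} {I : countType}.
Variables (C : I -> set V) (f : I -> nat -> V -> R) (D : set T) (A : set V).
Local Notation mu2 := (product_measure1 mu mu).
Local Notation VV := (V * V)%type.
Hypotheses (mD : measurable D) (D_gt0 : (0 < mu D)%E) (Cf : bump_base C f)
  (clA : closed A).
Variables (nu : T -> {charge set (borel V) -> \bar R})
  (q : T -> probability (borel V) R)
  (Lam : T * T -> {charge set (borel VV) -> \bar R})
  (lam : T * T -> probability (borel VV) R).
Hypotheses (nuq : {ae mu, forall x, D x -> charge_eq (nu x) (q x)})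
  (Lamlam : {ae mu2, forall z, (D `*` D) z -> charge_eq (Lam z) (lam z)})
  (Lam_tensor : {ae mu2, forall z, (D `*` D) z ->
     (exists p p' : probability (borel V) R,
        [/\ charge_eq (nu z.1) p, charge_eq (nu z.2) p' &
            charge_eq (Lam z) (p \x p')%E]) /\
     charge_support (Lam z) `<=` A `*` A}).

(** If [Lam] is the product of [nu] with itself and is carried by [A `*` A], then
    the kernels representing them satisfy the same relation on rectangles, and
    almost every [q x] is carried by [A]. *)
Lemma tensor_values :
  {ae mu, forall x, D x -> q x (A : set (borel V)) = 1%E} /\
  {ae mu2, forall z, (D `*` D) z ->
    forall B B' : set (borel V), measurable B -> measurable B' ->
      lam z (B `*` B' : set (borel VV)) = (q z.1 B * q z.2 B')%E}.
Proof.
have CCf := bump_base_pair Cf Cf.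
have clAA : closed (A `*` A).
  rewrite (_ : A `*` A = (fst @^-1` A) `&` (snd @^-1` A))//.
  by apply: closedI; apply: closed_comp => // z _; [exact: cvg_fst|exact: cvg_snd].
have mA : measurable (A : set (borel V)).
  by rewrite -[A]setCK; apply: measurableC; apply: sub_sigma_algebra; exact: closed_openC.
have pA (p : probability (borel V) R) : (1 <= p A)%E -> p A = 1%E.
  by move=> p1; apply/eqP; rewrite eq_le p1 andbT probability_le1.
have lamq0 : {ae mu2, forall z, (D `*` D) z ->
    [/\ lam z (A `*` A : set (borel VV)) = 1%E, nu z.1 A = 1%E &
    forall B B' : set (borel V), measurable B -> measurable B' ->
      lam z (B `*` B' : set (borel VV)) = (q z.1 B * q z.2 B')%E]}.
  have qq0 := ae_setX nuq nuq.
  apply: filterS3 Lam_tensor Lamlam qq0 => z Hz LL qq Dz.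
  have [[p [p' [nup nup' Lp]]] suppA] := Hz Dz.
  have {}LL := LL Dz; have [q1 q2] := qq Dz.
  have lamE (B B' : set (borel V)) : measurable B -> measurable B' ->
      lam z (B `*` B' : set (borel VV)) = (p B * p' B')%E.
    move=> mB mB'; have mBB' := measurableX_borel mB mB'.
    by rewrite -LL// Lp// product_measure1E.
  have lamA : lam z (A `*` A : set (borel VV)) = 1%E.
    have mAA := measurableX_borel mA mA.
    have := etrans (esym (probability_setC (lam z) mAA))
      (charge_support_compl0 CCf LL clAA suppA).
    by move/eqP; rewrite sube_eq ?fin_num_measure// add0e eq_sym => /eqP.
  split=> //.
    rewrite nup//; apply: pA.
    rewrite -lamA (_ : p A = lam z (A `*` setT : set (borel VV))).
      have mAA : measurable (A `*` A : set (borel VV)) by exact: measurableX_borel.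
      have mAT : measurable (A `*` setT : set (borel VV)) by exact: measurableX_borel.
      by apply: (le_measure (lam z)); rewrite ?inE// => w [].
    by rewrite lamE// probability_setT mule1.
  by move=> B B' mB mB'; rewrite lamE// -nup// -nup'// q1// q2.
split; last by apply: filterS lamq0 => z Hz Dz; have [] := Hz Dz.
have nuA : {ae mu, forall x, D x -> nu x (A : set (borel V)) = 1%E}.
  apply: (ae_setX_fst mD D_gt0 (P := fun x => nu x A = 1%E)).
  by apply: filterS lamq0 => z Hz Dz; have [] := Hz Dz.
by apply: filterS2 nuA nuq => x h1 h2 Dx; rewrite -(h2 Dx)// h1.
Qed.

End tensor_values.


Section inclusions.
Context {R : realType} (n m : nat).
Variables (Omega : set 'rV[R]_n) (K : set ('rV[R]_m * 'rV[R]_m)).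
Hypotheses (n0 : (0 < n)%N) (Omega0 : Omega !=set0) (bOmega : bounded_set Omega)
  (oOmega : open Omega) (cK : compact K).
Local Notation X := (borel 'rV[R]_n).
Local Notation Y := (borel 'rV[R]_m).
Local Notation YY := ('rV[R]_m * 'rV[R]_m)%type.
Local Notation leb := (lebesgue_rV n).
Local Notation leb2 := (product_measure1 (lebesgue_rV n) (lebesgue_rV n)).
Local Notation OO := (Omega `*` Omega : set (X * X)).

Let mOmega : measurable (Omega : set X).
Proof. exact: sub_sigma_algebra. Qed.

Let Omega_lty : (leb Omega < +oo)%E.
Proof. exact: lebesgue_rV_lty. Qed.

Let Omega_gt0 : (0 < leb Omega)%E.
Proof. exact: lebesgue_rV_gt0. Qed.

Let mOO : measurable OO.
Proof. exact: measurableX. Qed.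

Let clK : closed K.
Proof. by apply: compact_closed cK; exact: norm_hausdorff. Qed.

Lemma YMinfty_sub_YMprod (Lam : X * X -> {charge set (borel YY) -> \bar R}) :
  YMinfty Omega K Lam ->
  exists2 P, max_cartesian (hat K) P & YMprod Omega P Lam.
Proof.
move=> [LamP [u [uK uLam]]].
have [C [f Cf]] := bump_base_rV R m.
have [lam [mlam Lamlam]] := Linfw_Pr_kernel (bump_base_pair Cf Cf) mOO LamP.
have mu_ l : measurable_fun (Omega : set X) (u l) by have [[]] := uK l.
have [nu [A [mnu AK H]]] := limit_structure Cf mOmega Omega_lty Omega_gt0 LamP mu_
  uLam mlam Lamlam clK (fun l => (uK l).2).
have [B AB maxB] := max_cartesian_extension (setX_hat AK).
exists (B `*` B) => //; split=> //.
exists (fun x => charge_of_finite_measure (nu x)).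
  split; last by apply: aeW => x _; exists (nu x).
  move=> phi C0phi; have [M phiM] := C0_bounded C0phi.
  have mphi := measurable_continuous_borel (C0_continuous C0phi).
  apply: measurable_funTS.
  rewrite (_ : (fun x => _) = EFin \o (fun x => \int[nu x]_y phi y)).
    by apply/measurable_EFinP; exact: (measurable_Rintegral_kernel mnu mphi phiM).
  apply/funext => x /=; rewrite (@charge_integralE _ _ _ (nu x))//.
  rewrite /Rintegral fineK//; apply: integrable_fin_num => //.
  apply: (bounded_integrable measurableT _ mphi (N := M)) => //.
  exact: le_lt_trans (probability_le1 (nu x) measurableT) (ltry 1).
apply: filterS H => z Hz Dz; have [Lz suppz] := Hz Dz; split.
  by exists (nu z.1), (nu z.2).
by move=> w /suppz[Aw1 Aw2]; split; apply: AB.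
Qed.

Lemma YMprod_sub_YMinfty (Lam : X * X -> {charge set (borel YY) -> \bar R}) P :
  max_cartesian (hat K) P -> YMprod Omega P Lam -> YMinfty Omega K Lam.
Proof.
move=> maxP [LamP [nu nuP H]]; split=> //.
have [A [PA AK _]] := maxP; rewrite {}PA in maxP AK H.
have cA : compact A := max_cartesian_compact cK maxP.
have clA : closed A by apply: compact_closed cA; exact: norm_hausdorff.
have clAA : closed (A `*` A).
  by apply: compact_closed (compact_setX cA cA); exact: norm_hausdorff.
have [C [f Cf]] := bump_base_rV R m.
have CCf := bump_base_pair Cf Cf.
have [E [e Ee]] := bump_base_rV R n.
have [lam [mlam Lamlam]] := Linfw_Pr_kernel CCf mOO LamP.
have [q [mq nuq]] := Linfw_Pr_kernel Cf mOmega nuP.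
have mclosed (S : set 'rV[R]_m) : closed S -> measurable (S : set Y).
  move=> clS; rewrite -[S]setCK; apply: measurableC; apply: sub_sigma_algebra.
  exact: closed_openC.
have mA := mclosed _ clA.
have mAA : measurable (A `*` A : set (borel YY)) by exact: measurableX_borel.
have [qA lamq] := tensor_values mOmega Omega_gt0 Cf clA nuq Lamlam H.
(* A carries a probability measure *)
have [a0 Aa0] : A !=set0.
  apply: contrapT => A0.
  have {}A0 : A = set0 by apply/seteqP; split=> // x Ax; apply: A0; exists x.
  have [N [mN N0 QN]] := qA.
  have : (leb Omega <= leb N)%E.
    apply: le_measure; rewrite ?inE// => x Ox; apply: QN => /= /(_ Ox).
    by rewrite A0 measure0 => /eqP; rewrite eq_sym onee_eq0.
  by rewrite [X in (_ <= X)%E -> _]N0 leNgt Omega_gt0.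
have divO : divisible leb Omega.
  move=> Q w mQ QO w0 wQ; apply: lebesgue_rV_split => //.
  by have [M [Mr OM]] := bOmega; exists M; split=> // M' /OM OM' x /QO; exact: OM'.
have ET : range E setT by have [_ _ _ [i Ei] _] := Ee; exists i.
have [u [mu_ uA uconv]] := generating_sequence mOmega Omega_lty divO
  (measurable_baseE Ee) (setI_closed_base Ee) ET Cf cA Aa0 mq mlam qA lamq.
exists u; split.
  move=> j; split; last first.
    by apply: aeW => z _; have [] := AK (u j z.1, u j z.2) (conj (uA j z.1) (uA j z.2)).
  split; first exact: measurable_funTS.
  have [M [_ AM]] := compact_bounded cA.
  exists (`|M| + 1); apply: aeW => x _; apply: AM; last exact: uA.
  by rewrite (le_lt_trans (ler_norm _))// ltrDl.
move=> h phi ih C0phi.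
have cphi := C0_continuous C0phi; have [M phiM] := C0_bounded C0phi.
have mphi := measurable_continuous_borel cphi.
have mPhi := measurable_Rintegral_kernel mlam mphi phiM.
have PhiM z := Rintegral_prob_le lam mphi phiM z.
have OOoo : (leb2 OO < +oo)%E by exact: setX_lty.
have ihM (g : X * X -> R) (N : R) : measurable_fun OO g ->
    (forall z, `|g z| <= N) -> leb2.-integrable OO (EFin \o (fun z => h z * g z)).
  move=> mg gN.
  exact: (@integrable_mulg _ _ _ leb2 OO (fun=> g) N mOO (fun=> mg) (fun _ z _ => gN z) 0%N).
have ihPhi := ihM _ _ (measurable_funTS mPhi) PhiM.
have -> : (\int[leb2]_(z in OO) ((h z)%:E * charge_integral (Lam z) phi))%E =
    (\int[leb2]_(z in OO) (h z * \int[lam z]_w phi w))%:E.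
  rewrite /Rintegral fineK; last exact: integrable_fin_num.
  have mh := measurable_int leb2 ih.
  apply: ae_eq_integral => //.
  - by apply: emeasurable_funM => //; exact: LamP.1.
  - exact: measurable_int ihPhi.
  - apply: filterS Lamlam => z LL Dz; rewrite (charge_integralE _ (LL Dz)) EFinM.
    rewrite /Rintegral fineK//; apply: integrable_fin_num => //.
    apply: (bounded_integrable measurableT _ mphi (N := M)) => //.
    exact: le_lt_trans (probability_le1 (lam z) measurableT) (ltry 1).
have mv j : measurable_fun OO (fun z => phi (u j z.1, u j z.2)).
  apply: measurable_funTS; apply: (measurableT_comp mphi).
  apply: (measurableT_comp (measurable_pair_borel Cf Cf)).
  apply/measurable_fun_pairP; split.
    exact: (measurableT_comp (mu_ j) measurable_fst).
  exact: (measurableT_comp (mu_ j) measurable_snd).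
have jE j : (\int[leb2]_(z in OO) (h z * phi (u j z.1, u j z.2))%:E)%E =
    (\int[leb2]_(z in OO) (h z * (phi (u j z.1, u j z.2) - \int[lam z]_w phi w)) +
     \int[leb2]_(z in OO) (h z * \int[lam z]_w phi w))%:E.
  rewrite -RintegralD//.
    rewrite /Rintegral fineK.
      by apply: eq_integral => z _; rewrite -mulrDr subrK.
    apply: integrable_fin_num => //.
    rewrite (_ : (fun x => _) = EFin \o (fun z => h z * phi (u j z.1, u j z.2))).
      exact: ihM (mv j) (fun z => phiM _).
    by apply/funext => z /=; rewrite -mulrDr subrK.
  apply: (ihM (fun z => phi (u j z.1, u j z.2) - \int[lam z]_w phi w) (M + M)).
    by apply: measurable_funB => //; exact: measurable_funTS.
  by move=> z; apply: (le_trans (ler_normB _ _)); rewrite lerD.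
rewrite (_ : (fun j => _) = fun j =>
    (\int[leb2]_(z in OO) (h z * (phi (u j z.1, u j z.2) - \int[lam z]_w phi w)) +
     \int[leb2]_(z in OO) (h z * \int[lam z]_w phi w))%:E); last first.
  by apply/funext => j; exact: jE.
apply: cvg_EFin; first exact: nearW.
rewrite -[X in _ --> X]add0r; apply: cvgD; last exact: cvg_cst.
exact: uconv.
Qed.

End inclusions.

Theorem theorem5p12 (R : realType) (n m : nat) (Omega : set 'rV[R]_n)
    (K : set ('rV[R]_m * 'rV[R]_m)) :
  (0 < n)%N ->
  Omega !=set0 -> bounded_set Omega -> open Omega ->
  compact K ->
  YMinfty Omega K = \bigcup_(P in max_cartesian (hat K)) YMprod Omega P.
Proof.
move=> n0 Omega0 bOmega oOmega cK; apply/seteqP; split=> Lam.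
  by move=> /(YMinfty_sub_YMprod Omega0 bOmega oOmega cK)[P maxP LamP]; exists P.
move=> [P maxP LamP].
exact: (YMprod_sub_YMinfty n0 Omega0 bOmega oOmega cK maxP LamP).
Qed.
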